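(* Let $d\ge1$ and let $\mu^0\in\operatorname{Comp}_d(1)$. For any classical link $K$, $$\Gamma^\gamma_{Y,\mu^0}(K)=\Gamma_{\mathcal H}(K).$$ In particular, the set of invariants $\Gamma^\gamma_{Y,\rho}$ for classical links obtained from the algebras $Y_{d,n}$ (with $\rho$ a Markov trace on $\{Y_{d,n}\}_{n\ge1}$) contains the HOMFLYPT polynomial $\Gamma_{\mathcal H}$.
   Context: Let $u,v,\gamma$ be indeterminates, $B=\mathbb C[u^{\pm1},v^{\pm1}]$, $R=\mathbb C[u^{\pm1},v^{\pm1},\gamma^{\pm1}]$, and let $\xi_1,\dots,\xi_d$ be the $d$-th roots of unity in $\mathbb C$. Hecke algebra: $\mathcal H_n$ ($n\ge1$) is the unital $B$-algebra with generators $T_1,\dots,T_{n-1}$ and relations $T_iT_j=T_jT_i$ ($|i-j|>1$), $T_iT_{i+1}T_i=T_{i+1}T_iT_{i+1}$, $T_i^2=u^2+vT_i$; $\mathcal H_0=B$; $\mathcal H_n\subset\mathcal H_{n+1}$ naturally. $\{\tau_n:\mathcal H_n\to B\}_{n\ge1}$ is the unique family of $B$-linear maps with $\tau_1(1)=1$, $\tau_n(xy)=\tau_n(yx)$, $\tau_{n+1}(xT_n)=\tau_{n+1}(xT_n^{-1})=\tau_n(x)$ for $x,y\in\mathcal H_n$; $\tau_0=\mathrm{id}_B$. Permutations are multiplied as functions, $s_i=(i,i+1)$; for $w=s_{i_1}\cdots s_{i_r}$ reduced, $\tilde T_w=u^{-r}T_{i_1}\cdots T_{i_r}$. Yokonuma--Hecke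 algebra: $Y_{d,n}$ is the unital $B$-algebra with generators $g_1,\dots,g_{n-1},t_1,\dots,t_n$ and relations $g_ig_j=g_jg_i$ ($|i-j|>1$), $g_ig_{i+1}g_i=g_{i+1}g_ig_{i+1}$, $t_it_j=t_jt_i$, $g_it_j=t_{s_i(j)}g_i$, $t_j^d=1$, $g_i^2=u^2+v\,e_ig_i$, with $e_i=\frac1d\sum_{s=0}^{d-1}t_i^st_{i+1}^{-s}$; $Y_{d,n}\subset Y_{d,n+1}$ naturally; $RY_{d,n}=R\otimes_BY_{d,n}$. For $w=s_{i_1}\cdots s_{i_r}$ reduced, $\tilde g_w=u^{-r}g_{i_1}\cdots g_{i_r}$. A Markov trace on $\{Y_{d,n}\}_{n\ge1}$ is a family of $B$-linear maps $\rho_n:Y_{d,n}\to B$ with $\rho_n(xy)=\rho_n(yx)$ and $\rho_{n+1}(xg_n)=\rho_{n+1}(xg_n^{-1})=\rho_n(x)$ for all $n\ge1$, $x,y\in Y_{d,n}$; it is extended $R$-linearly to $RY_{d,n}\to R$. Compositions: $\operatorname{Comp}_d(n)$ is the set of $d$-tuples of non-negative integers with sum $n$; $[\mu]_a=1$ if $\mu_a\ge1$ and $0$ otherwise; $\operatorname{Comp}^0_d$ is the set of non-zero $d$-tuples with entries in $\{0,1\}$ (it contains $\operatorname{Comp}_d(1)$). $\mathfrak S^\mu\subset\mathfrak S_n$ is the Young subgroup acting on consecutive blocks of sizes $\mu_1,\dots,\mu_d$; $\mathcal H^\mu\subset\mathcal H_n$ is the subalgebra generated by the $T_i$ with $s_i\in\mathfrak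 S^\mu$, identified with $\mathcal H_{\mu_1}\otimes\dots\otimes\mathcal H_{\mu_d}$; $m_\mu=n!/(\mu_1!\cdots\mu_d!)$. Characters: for a character $\chi$ of $(\mathbb Z/d\mathbb Z)^n=\langle t_1,\dots,t_n\rangle$, $E_\chi=\prod_{i=1}^n\bigl(\frac1d\sum_{s=0}^{d-1}\chi(t_i)^st_i^{-s}\bigr)$; $w(\chi)(t_i)=\chi(t_{w^{-1}(i)})$ for $w\in\mathfrak S_n$; $\operatorname{Comp}(\chi)=\mu$ with $\mu_a=\#\{j:\chi(t_j)=\xi_a\}$; $E_\mu=\sum_{\operatorname{Comp}(\chi)=\mu}E_\chi$. $\chi_1^\mu$ takes value $\xi_1$ on the first $\mu_1$ of the $t_j$'s, $\xi_2$ on the next $\mu_2$, etc.; $\pi_{1,\mu}=1,\dots,\pi_{m_\mu,\mu}$ are the minimal length representatives of $\mathfrak S_n/\mathfrak S^\mu$; $\chi_k^\mu=\pi_{k,\mu}(\chi_1^\mu)$. $\Psi_\mu:E_\mu Y_{d,n}\to\operatorname{Mat}_{m_\mu}(\mathcal H^\mu)$ is the algebra isomorphism given on the basis $\{E_{\chi_k^\mu}\tilde g_w\}$ by $\Psi_\mu(E_{\chi_k^\mu}\tilde g_w)=\tilde T_{\pi_{k,\mu}^{-1}w\pi_{j,\mu}}\mathrm M_{k,j}$, where $w(\chi_j^\mu)=\chi_k^\mu$ and $\mathrm M_{k,j}$ is the elementary matrix. Basic Markov traces: for $\mu^0\in\operatorname{Comp}^0_d$, $\rho_{\mu^0,n}(x)=\sum_{\mu\in\operatorname{Comp}_d(n),\,[\mu]=\mu^0}(\tau_{\mu_1}\otimes\dots\otimes\tau_{\mu_d})\circ\operatorname{Tr}_{\operatorname{Mat}_{m_\mu}}\circ\Psi_\mu(E_\mu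 x)$, where $\operatorname{Tr}_{\operatorname{Mat}_{m_\mu}}$ is the sum of diagonal entries; $\{\rho_{\mu^0,n}\}_{n\ge1}$ is a Markov trace. Invariants: $B_n$ is the braid group with standard generators $\sigma_1,\dots,\sigma_{n-1}$. For a classical (oriented) link $K$ let $\beta_K\in B_n$ be a braid with closure $K$. Let $\delta^\gamma_{Y,n}:R[B_n]\to RY_{d,n}$ be the algebra homomorphism $\sigma_i\mapsto(\gamma+(1-\gamma)e_i)g_i$ and $\delta_{\mathcal H,n}:B[B_n]\to\mathcal H_n$ the algebra homomorphism $\sigma_i\mapsto T_i$. For a Markov trace $\rho=\{\rho_n\}$, $\Gamma^\gamma_{Y,\rho}(K)=\rho_n\circ\delta^\gamma_{Y,n}(\beta_K)$; $\Gamma^\gamma_{Y,\mu^0}$ is the one for $\{\rho_{\mu^0,n}\}$. The HOMFLYPT polynomial is $\Gamma_{\mathcal H}(K)=\tau_n\circ\delta_{\mathcal H,n}(\beta_K)$. These are isotopy invariants (independent of the choice of $\beta_K$). *)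

(* Defs.v *)
From HB Require Import structures.
From mathcomp Require Import all_boot all_order all_algebra all_fingroup.
From mathcomp Require Import fraction generic_quotient complex finmap monalg.
From mathcomp Require Import all_classical all_reals topology normedtype trigo.

Set Implicit Arguments.
Unset Strict Implicit.
Unset Printing Implicit Defensive.

Import Order.TTheory GRing.Theory Num.Theory numFieldNormedType.Exports.

Local Open Scope classical_set_scope.
Local Open Scope quotient_scope.
Local Open Scope ring_scope.

(** * Laurent polynomials *)

(* A[X^{+-1}], as the subring of Frac(A[X]) of the fractions p / X^n. *)
Section Laurent.
Variable A : idomainType.

Definition laurent_pred : {pred {fraction {poly A}}} :=
  fun f => `[< exists n (p : {poly A}),
                 f * FracField.tofrac 'X ^+ n = FracField.tofrac p >].

Record laurent := Laurent {
  laurent_val :> {fraction {poly A}};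
  laurent_valP : laurent_val \in laurent_pred }.

HB.instance Definition _ := [isSub for laurent_val].
HB.instance Definition _ := [Choice of laurent by <:].

Lemma tofrac_laurent (p : {poly A}) : FracField.tofrac p \in laurent_pred.
Proof. by apply/asboolP; exists 0%N, p; rewrite expr0 mulr1. Qed.

Lemma laurent_subring : subring_closed laurent_pred.
Proof.
split=> [|f g /asboolP[n [p fE]] /asboolP[m [q gE]]
         |f g /asboolP[n [p fE]] /asboolP[m [q gE]]].
- by rewrite -(rmorph1 (@FracField.tofrac _)) tofrac_laurent.
- apply/asboolP; exists (n + m)%N, (p * 'X^m - q * 'X^n).
  rewrite rmorphB !rmorphM !rmorphXn /= -fE -gE mulrBl exprD mulrA.
  by congr (_ - _); rewrite -mulrA [X in g * X]mulrC mulrA.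
- apply/asboolP; exists (n + m)%N, (p * q).
  by rewrite rmorphM /= -fE -gE exprD mulrACA.
Qed.

HB.instance Definition _ :=
  GRing.isSubringClosed.Build {fraction {poly A}} laurent_pred laurent_subring.
HB.instance Definition _ := [SubChoice_isSubComNzRing of laurent by <:].

Definition laurent_unit : {pred laurent} := fun x => `[< exists y, y * x = 1 >].
Definition laurent_inv (x : laurent) : laurent := xget x [set y | y * x = 1].

Lemma laurent_mulVx : {in laurent_unit, left_inverse 1 laurent_inv *%R}.
Proof.
move=> x /asboolP[y yx]; rewrite /laurent_inv.
by case: xgetP => [z _ //|/(_ y)].
Qed.

Lemma laurent_unitPl x y : y * x = 1 -> x \in laurent_unit.
Proof. by move=> yx; apply/asboolP; exists y. Qed.

Lemma laurent_inv_out : {in [predC laurent_unit], laurent_inv =1 id}.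
Proof.
move=> x /asboolPn xNu; rewrite /laurent_inv.
by case: xgetP => [z _ zx|//]; case: xNu; exists z.
Qed.

HB.instance Definition _ := GRing.ComNzRing_hasMulInverse.Build laurent
  laurent_mulVx laurent_unitPl laurent_inv_out.

Lemma laurent_integral (x y : laurent) : x * y = 0 -> (x == 0) || (y == 0).
Proof. by move/(congr1 val) => /= /eqP; rewrite mulf_eq0. Qed.

HB.instance Definition _ :=
  GRing.ComUnitRing_isIntegral.Build laurent laurent_integral.

Definition laurentC (a : A) : laurent := Laurent (tofrac_laurent a%:P).
Definition laurentX : laurent := Laurent (tofrac_laurent 'X).

End Laurent.

(** * Algebras given by generators and relations *)

(* The free K-algebra on I is the monoid algebra of the free monoid on I. *)
Notation free_alg K I := {malg K[{fmonom I}]}.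

Section PresentedAlgebra.
Variables (K : idomainType) (I : choiceType) (rel : set (free_alg K I)).
Local Notation F := (free_alg K I).

Definition two_sided_ideal (J : set F) :=
  [/\ J 0, forall x y, J x -> J y -> J (x - y)
    & forall a x b, J x -> J (a * x * b)].

Definition rel_ideal : set F := smallest two_sided_ideal rel.

Lemma rel_idealP : two_sided_ideal rel_ideal.
Proof.
split=> [J [[J0 _ _] _] //|x y Jx Jy J [idJ rJ]|a x b Jx J [idJ rJ]].
- by have [_ JB _] := idJ; apply: JB; [apply: Jx|apply: Jy].
- by have [_ _ JM] := idJ; apply: JM; apply: Jx.
Qed.

Definition rel_equiv : ssrbool.rel F := fun x y => `[< rel_ideal (x - y) >].

Let id0 : rel_ideal 0. Proof. by case: rel_idealP. Qed.
Let idB x y : rel_ideal x -> rel_ideal y -> rel_ideal (x - y).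
Proof. by case: rel_idealP => _ + _; apply. Qed.
Let idN x : rel_ideal x -> rel_ideal (- x).
Proof. by move=> ?; rewrite -sub0r; apply: idB. Qed.
Let idD x y : rel_ideal x -> rel_ideal y -> rel_ideal (x + y).
Proof. by move=> ? ?; rewrite -[y]opprK; apply: idB => //; apply: idN. Qed.
Let idM a x b : rel_ideal x -> rel_ideal (a * x * b).
Proof. by case: rel_idealP => _ _; apply. Qed.

Lemma rel_equiv_refl : reflexive rel_equiv.
Proof. by move=> x; apply/asboolP; rewrite subrr. Qed.
Lemma rel_equiv_sym : symmetric rel_equiv.
Proof.
by move=> x y; apply/asboolP/asboolP => /idN; rewrite opprB.
Qed.
Lemma rel_equiv_trans : transitive rel_equiv.
Proof.
move=> y x z /asboolP xy /asboolP yz; apply/asboolP.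
by move: (idD xy yz); rewrite addrA subrK.
Qed.

Canonical rel_equivP :=
  EquivRel rel_equiv rel_equiv_refl rel_equiv_sym rel_equiv_trans.

Definition pres_alg := {eq_quot rel_equiv}.

HB.instance Definition _ : EqQuotient _ rel_equiv pres_alg :=
  EqQuotient.on pres_alg.
HB.instance Definition _ := Choice.on pres_alg.

Local Notation Q := pres_alg.

Let pi_eq (x y : F) : rel_ideal (x - y) -> \pi_Q x = \pi_Q y.
Proof. by move=> xy; apply/eqP; rewrite eqquotE; apply/asboolP. Qed.
Let repr_pi (x : F) : rel_ideal (x - repr (\pi_Q x)).
Proof.
by apply/asboolP; rewrite -/(rel_equiv _ _) -(eqquotE Q) reprK.
Qed.

Definition pres_add := lift_op2 Q +%R.
Definition pres_opp := lift_op1 Q -%R.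
Definition pres_mul := lift_op2 Q *%R.
Definition pres_scale (a : K) := lift_op1 Q ( *:%R a).

Lemma pres_addE x y : pres_add (\pi_Q x) (\pi_Q y) = \pi_Q (x + y).
Proof.
rewrite /pres_add; unlock; apply/esym/pi_eq.
by rewrite opprD addrACA; exact: (idD (repr_pi _) (repr_pi _)).
Qed.
Lemma pres_oppE x : pres_opp (\pi_Q x) = \pi_Q (- x).
Proof.
rewrite /pres_opp; unlock; apply/esym/pi_eq.
by rewrite -opprD; exact: (idN (repr_pi _)).
Qed.
Lemma pres_mulE x y : pres_mul (\pi_Q x) (\pi_Q y) = \pi_Q (x * y).
Proof.
rewrite /pres_mul; unlock; apply/esym/pi_eq; set x' := repr _; set y' := repr _.
have -> : x * y - x' * y' = (x - x') * y + x' * (y - y').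
  by rewrite mulrBl mulrBr addrA subrK.
apply: (@idD ((x - x') * y) (x' * (y - y'))).
  by rewrite -[(x - x') * y]mul1r mulrA; exact: (idM _ _ (repr_pi _)).
by rewrite -[x' * _]mulr1; exact: (idM _ _ (repr_pi _)).
Qed.
Lemma pres_scaleE a x : pres_scale a (\pi_Q x) = \pi_Q (a *: x).
Proof.
rewrite /pres_scale; unlock; apply/esym/pi_eq.
rewrite -scalerBr -[x - _]mul1r scalerAl -[_ * _]mulr1.
exact: (idM _ _ (repr_pi _)).
Qed.

Let presE := (pres_addE, pres_oppE, pres_mulE, pres_scaleE).

Lemma pres_addA : associative pres_add.
Proof.
by elim/quotW=> x; elim/quotW=> y; elim/quotW=> z;
   rewrite !presE addrA.
Qed.
Lemma pres_addC : commutative pres_add.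
Proof. by elim/quotW=> x; elim/quotW=> y; rewrite !presE addrC. Qed.
Lemma pres_add0 : left_id (\pi_Q 0) pres_add.
Proof. by elim/quotW=> ?; rewrite !presE add0r. Qed.
Lemma pres_addN : left_inverse (\pi_Q 0) pres_opp pres_add.
Proof. by elim/quotW=> ?; rewrite !presE addNr. Qed.

HB.instance Definition _ :=
  GRing.isZmodule.Build pres_alg pres_addA pres_addC pres_add0 pres_addN.

Lemma pres_mulA : associative pres_mul.
Proof.
by elim/quotW=> x; elim/quotW=> y; elim/quotW=> z;
   rewrite !presE mulrA.
Qed.
Lemma pres_mul1 : left_id (\pi_Q 1) pres_mul.
Proof. by elim/quotW=> ?; rewrite !presE mul1r. Qed.
Lemma pres_mulr1 : right_id (\pi_Q 1) pres_mul.
Proof. by elim/quotW=> ?; rewrite !presE mulr1. Qed.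
Lemma pres_mulDl : left_distributive pres_mul +%R.
Proof.
by elim/quotW=> x; elim/quotW=> y; elim/quotW=> z;
   rewrite /GRing.add /= !presE mulrDl.
Qed.
Lemma pres_mulDr : right_distributive pres_mul +%R.
Proof.
by elim/quotW=> x; elim/quotW=> y; elim/quotW=> z;
   rewrite /GRing.add /= !presE mulrDr.
Qed.

(* Not an nzRingType: nothing prevents the relations from implying 1 = 0. *)
HB.instance Definition _ := GRing.Zmodule_isPzRing.Build pres_alg
  pres_mulA pres_mul1 pres_mulr1 pres_mulDl pres_mulDr.

Lemma pres_scaleA a b x : pres_scale a (pres_scale b x) = pres_scale (a * b) x.
Proof. by elim/quotW: x => x; rewrite !presE scalerA. Qed.
Lemma pres_scale1 : left_id 1 pres_scale.
Proof. by elim/quotW=> x; rewrite !presE scale1r. Qed.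
Lemma pres_scaleDr : right_distributive pres_scale +%R.
Proof.
move=> a; elim/quotW=> x; elim/quotW=> y.
by rewrite /GRing.add /= !presE scalerDr.
Qed.
Lemma pres_scaleDl x : {morph pres_scale^~ x : a b / a + b}.
Proof.
by elim/quotW: x => x a b; rewrite [in RHS]/GRing.add /= !presE scalerDl.
Qed.

HB.instance Definition _ := GRing.Zmodule_isLmodule.Build K pres_alg
  pres_scaleA pres_scale1 pres_scaleDr pres_scaleDl.

Definition free_gen (i : I) : F := << fmu i >>.
Definition gen (i : I) : pres_alg := \pi_Q (free_gen i).

End PresentedAlgebra.

(* The algebra homomorphism i |-> f i, computed on a representative; it does
   not depend on the latter when f satisfies the relations rel. *)
Definition pres_lift (K : idomainType) (I J : choiceType)
    (rel : set (free_alg K I)) (rel' : set (free_alg K J))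
    (f : I -> pres_alg rel') (x : pres_alg rel) : pres_alg rel' :=
  \sum_(m <- msupp (repr x)) (repr x)@_m *: \prod_(i <- (m : seq I)) f i.

(** * Extension of scalars *)

Section BaseChange.
Variables (K L : idomainType) (iota : K -> L) (I : choiceType).
Variable rel : set (free_alg K I).
Local Notation A := (pres_alg rel).
Local Notation pure a := (@free_gen L A a).

(* L (x)_K A is the L-algebra generated by the elements pure a = 1 (x) a,
   subject to the relations stating that a |-> 1 (x) a is a ring morphism which maps
   the scalars of K to those of L. *)
Inductive base_change_rel : set (free_alg L A) :=
| BaseChangeD a b : base_change_rel (pure (a + b) - (pure a + pure b))
| BaseChangeM a b : base_change_rel (pure (a * b) - pure a * pure b)
| BaseChange1 : base_change_rel (pure 1 - 1)
| BaseChangeZ k a : base_change_rel (pure (k *: a) - iota k *: pure a).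

Definition base_change := pres_alg base_change_rel.

Definition to_base_change (a : A) : base_change := gen base_change_rel a.

(* The L-linear extension l (x) a |-> l * iota (f a) of a K-linear f, computed
   on a representative \sum_m l_m m, where m = (pure a_1)...(pure a_k). *)
Definition extend_scalars (f : A -> K) (x : base_change) : L :=
  \sum_(m <- msupp (repr x))
     (repr x)@_m * iota (f (\prod_(a <- (m : seq A)) a)).

End BaseChange.

Definition two_sided_inv (A : pzRingType) (x : A) : A :=
  xget 0 [set y | x * y = 1 /\ y * x = 1].

(** * Permutations *)

Section Permutations.
Variable n : nat.

(* i : 'I_n.-1 stands for the pair of consecutive elements i, i+1 of 'I_n. *)
Lemma lo_proof (i : 'I_n.-1) : (i < n)%N.
Proof. by apply: leq_trans (ltn_ord i) (leq_pred n). Qed.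
Lemma hi_proof (i : 'I_n.-1) : (i.+1 < n)%N.
Proof. by rewrite -ltn_predRL. Qed.

Definition lo (i : 'I_n.-1) : 'I_n := Ordinal (lo_proof i).
Definition hi (i : 'I_n.-1) : 'I_n := Ordinal (hi_proof i).

Definition adj (i : 'I_n.-1) : 'S_n := tperm (lo i) (hi i).

(* Product of permutations as functions: mathcomp's s * t applies s first. *)
Definition pcomp (s t : 'S_n) : 'S_n := (t * s)%g.

Definition word_perm (s : seq 'I_n.-1) : 'S_n :=
  foldr (fun i w => pcomp (adj i) w) 1%g s.

Definition reduced (w : 'S_n) (s : seq 'I_n.-1) :=
  word_perm s = w /\ forall s', word_perm s' = w -> (size s <= size s')%N.

Definition reduced_word (w : 'S_n) : seq 'I_n.-1 := xget [::] (reduced w).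

Definition perm_length (w : 'S_n) : nat := size (reduced_word w).

End Permutations.

(** * Compositions and characters *)

Section Compositions.
Variables (d n : nat).

(* An entry of a composition of n is at most n. *)
Definition comp_type := {ffun 'I_d -> 'I_n.+1}.

Definition Comp : {set comp_type} :=
  [set mu : comp_type | (\sum_a mu a)%N == n]%SET.

Definition comp_supp (mu : comp_type) : {ffun 'I_d -> 'I_2} :=
  [ffun a => inord (0 < mu a)%N].

Definition multinomial (mu : comp_type) : nat :=
  (n`! %/ \prod_a (mu a)`!)%N.

Definition block_start (mu : comp_type) (a : 'I_d) : nat :=
  (\sum_(b < d | (b < a)%N) mu b)%N.

(* The character chi of (Z/dZ)^n such that chi(t_j) = xi_(c j). *)
Definition character := {ffun 'I_n -> 'I_d}.

Definition perm_char (w : 'S_n) (chi : character) : character :=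
  [ffun j => chi ((w^-1)%g j)].

Definition char_comp (chi : character) : comp_type :=
  [ffun a => inord #|[set j | chi j == a]%SET|].

Hypothesis d_gt0 : (0 < d)%N.

(* The index of the block which contains j; Ordinal d_gt0 is a dummy default. *)
Definition block (mu : comp_type) (j : 'I_n) : 'I_d :=
  nth (Ordinal d_gt0) (flatten [seq nseq (mu a) a | a <- enum 'I_d]) j.

Definition char1 (mu : comp_type) : character := [ffun j => block mu j].

Definition young (mu : comp_type) : set 'S_n :=
  [set w | forall j, block mu (w j) = block mu j].

Definition min_rep (mu : comp_type) (p : 'S_n) :=
  forall y, young mu y -> (perm_length p <= perm_length (pcomp p y))%N.

(* p enumerates the minimal length representatives of S_n / S^mu, from 1. *)
Definition min_rep_enum (mu : comp_type) (p : 'I_(multinomial mu) -> 'S_n) :=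
  [/\ injective p, range p = min_rep mu
    & forall k : 'I_(multinomial mu), val k = 0%N -> p k = 1%g].

End Compositions.

(** * Braids *)

Section Braids.
Variable n : nat.

(* (i, true) is sigma_i and (i, false) is its inverse. *)
Definition braid_word := seq ('I_n.-1 * bool).

Inductive braid_eq : braid_word -> braid_word -> Prop :=
| BraidRefl x : braid_eq x x
| BraidSym x y : braid_eq x y -> braid_eq y x
| BraidTrans x y z : braid_eq x y -> braid_eq y z -> braid_eq x z
| BraidCat x x' y y' :
    braid_eq x x' -> braid_eq y y' -> braid_eq (x ++ y) (x' ++ y')
| BraidCancel i e : braid_eq [:: (i, e); (i, ~~ e)] [::]
| BraidFar (i j : 'I_n.-1) : (i.+1 < j)%N ->
    braid_eq [:: (i, true); (j, true)] [:: (j, true); (i, true)]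
| BraidNear (i j : 'I_n.-1) : i.+1 = j :> nat ->
    braid_eq [:: (i, true); (j, true); (i, true)]
             [:: (j, true); (i, true); (j, true)].

Definition braid_eqb : ssrbool.rel braid_word := fun x y => `[< braid_eq x y >].

Lemma braid_eqb_refl : reflexive braid_eqb.
Proof. by move=> x; apply/asboolP; apply: BraidRefl. Qed.
Lemma braid_eqb_sym : symmetric braid_eqb.
Proof. by move=> x y; apply/asboolP/asboolP => /BraidSym. Qed.
Lemma braid_eqb_trans : transitive braid_eqb.
Proof.
by move=> y x z /asboolP xy /asboolP yz; apply/asboolP; apply: BraidTrans yz.
Qed.

Canonical braid_eqbP :=
  EquivRel braid_eqb braid_eqb_refl braid_eqb_sym braid_eqb_trans.

Definition braid := {eq_quot braid_eqb}.

HB.instance Definition _ : EqQuotient _ braid_eqb braid := EqQuotient.on braid.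
HB.instance Definition _ := Choice.on braid.

Definition word_inv (x : braid_word) : braid_word :=
  rev [seq (l.1, ~~ l.2) | l <- x].

Definition braid_one : braid := \pi_braid [::].
Definition braid_mul := lift_op2 braid (@cat ('I_n.-1 * bool)).
Definition braid_inv := lift_op1 braid word_inv.

Let pi_eq (x y : braid_word) : braid_eq x y -> \pi_braid x = \pi_braid y.
Proof. by move=> xy; apply/eqP; rewrite eqquotE; apply/asboolP. Qed.
Let repr_pi (x : braid_word) : braid_eq (repr (\pi_braid x)) x.
Proof.
by apply/asboolP; rewrite -/(braid_eqb _ _) -(eqquotE braid) reprK.
Qed.

Lemma braid_mulE x y :
  braid_mul (\pi_braid x) (\pi_braid y) = \pi_braid (x ++ y).
Proof.
by rewrite /braid_mul; unlock; apply/pi_eq/BraidCat; apply: repr_pi.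
Qed.

Lemma word_mulV (x : braid_word) : braid_eq (x ++ word_inv x) [::].
Proof.
elim: x => [|[i e] x IH]; first exact: BraidRefl.
rewrite /word_inv /= rev_cons -rcons_cat -cats1 -/(word_inv x).
apply: BraidTrans (BraidCancel i e).
apply: (BraidCat (BraidRefl [:: (i, e)])).
exact: (BraidCat IH (BraidRefl [:: (i, ~~ e)])).
Qed.

Lemma word_invK : involutive word_inv.
Proof.
move=> x; rewrite /word_inv map_rev revK -map_comp -[RHS]map_id.
by apply: eq_map => -[i e] /=; rewrite negbK.
Qed.

Lemma braid_mulA : associative braid_mul.
Proof.
by elim/quotW=> x; elim/quotW=> y; elim/quotW=> z;
   rewrite !braid_mulE catA.
Qed.
Lemma braid_mul1 : left_id braid_one braid_mul.
Proof. by elim/quotW=> x; rewrite braid_mulE. Qed.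
Lemma braid_mulr1 : right_id braid_one braid_mul.
Proof. by elim/quotW=> x; rewrite braid_mulE cats0. Qed.
Lemma braid_mulV : left_inverse braid_one braid_inv braid_mul.
Proof.
move=> x; rewrite /braid_inv; unlock; rewrite -{2}[x]reprK braid_mulE.
by apply/pi_eq; rewrite -{2}[repr x]word_invK; apply: word_mulV.
Qed.
Lemma braid_mulrV : right_inverse braid_one braid_inv braid_mul.
Proof.
move=> x; rewrite /braid_inv; unlock; rewrite -{1}[x]reprK braid_mulE.
by apply/pi_eq; apply: word_mulV.
Qed.

HB.instance Definition _ := isGroup.Build braid
  braid_mulA braid_mul1 braid_mulr1 braid_mulV braid_mulrV.

(* The homomorphism sigma_i |-> f i to the group of units of S, computed on a
   representing word. *)
Definition braid_lift (S : pzRingType) (f : 'I_n.-1 -> S) (b : braid) : S :=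
  \prod_(l <- (repr b : braid_word))
     (if l.2 then f l.1 else two_sided_inv (f l.1)).

End Braids.

(** * Links *)

Section Links.
Variable rT : realType.
Local Notation E3 := 'rV[rT]_3.

(* A link with c components: c disjoint oriented simple closed curves,
   parametrized by rT modulo 1. *)
Record link := Link {
  ncomp : nat;
  curve : 'I_ncomp -> rT -> E3;
  ncomp_gt0 : (0 < ncomp)%N;
  curve_continuous : forall i, continuous (curve i);
  curve_periodic : forall i t, curve i (t + 1) = curve i t;
  curve_inj : forall i j s t, curve i s = curve j t ->
    i = j /\ exists m : int, s - t = m%:~R }.

(* Ambient isotopy of oriented links. *)
Definition isotopic (K K' : link) :=
  exists (H G : rT -> E3 -> E3) (sigma : 'I_(ncomp K) -> 'I_(ncomp K'))
         (phi : 'I_(ncomp K) -> rT -> rT),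
  [/\ continuous (fun p : rT * E3 => H p.1 p.2)
      /\ continuous (fun p : rT * E3 => G p.1 p.2),
      (forall t, cancel (H t) (G t)) /\ (forall t, cancel (G t) (H t)),
      H 0 = id,
      bijective sigma
    & forall i,
      [/\ continuous (phi i), {homo phi i : s t / s < t},
          forall t, phi i (t + 1) = phi i t + 1
        & forall t, H 1 (curve i t) = curve (sigma i) (phi i t)]].

Definition polygonal (K : link) :=
  exists2 N : nat, (0 < N)%N &
  forall i (k : int) (s : rT), 0 <= s <= 1 ->
    curve i ((k%:~R + s) / N%:R) =
    (1 - s) *: @curve K i (k%:~R / N%:R) + s *: curve i ((k%:~R + 1) / N%:R).

Definition tame (K : link) := exists2 K', polygonal K' & isotopic K K'.

Record classical_link := ClassicalLink {
  underlying_link :> link;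
  classical_tame : tame underlying_link }.

Definition cylindrical (x th y : rT) : E3 :=
  \row_(i < 3) [:: x * cos th; x * sin th; y]`_i.

(* Position at time s in [0, 1] of the strand which starts at (j+1, 0), while
   the letter l is executed: sigma_i^{+-1} rotates the points (i+1, 0) and
   (i+2, 0) by +-pi around their midpoint; None lets all strands rest. *)
Definition strand n (l : option ('I_n.-1 * bool)) (s : rT) (j : 'I_n)
    : rT * rT :=
  if l is Some (i, e) then
    let c := i%:R + 1 + 2^-1 in
    let x := cos (pi * s) / 2 in
    let y := (-1) ^+ (~~ e) * sin (pi * s) / 2 in
    if j == lo i then (c - x, - y) else
    if j == hi i then (c + x, y) else (j%:R + 1, 0)
  else (j%:R + 1, 0).

(* The closure of w around the axis x = 0; the resting letter which is added
   accounts for the empty word. *)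
Definition closed_braid n (w : braid_word n) : set E3 :=
  let ls := rcons (map Some w) None in
  [set p | exists (k : nat) (s : rT) (j : 'I_n),
     [/\ (k < size ls)%N, 0 <= s <= 1
       & let xy := strand (nth None ls k) s j in
         p = cylindrical xy.1 (2 * pi * ((k%:R + s) / (size ls)%:R)) xy.2]].

(* K is the closure of w, oriented by increasing angles. *)
Definition is_closed_braid n (w : braid_word n) (K : link) :=
  \bigcup_i range (@curve K i) = closed_braid w /\
  forall i, exists th : rT -> rT,
    [/\ continuous th, {homo th : s t / s < t}
      & forall t, exists2 x, 0 < x
          & exists y, @curve K i t = cylindrical x (th t) y].

Definition is_closure n (b : braid n) (K : link) :=
  exists (w : braid_word n) (K' : link),
    [/\ b = \pi_(braid n) w, is_closed_braid w K' & isotopic K' K].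

End Links.

(** * Hecke and Yokonuma-Hecke algebras *)

Section Algebras.
Variable rT : realType.

Definition LaurB : idomainType := laurent (laurent rT[i]).
Definition LaurR : idomainType := laurent LaurB.

Definition constB (z : rT[i]) : LaurB := laurentC (laurentC z).
Definition u : LaurB := laurentC (laurentX rT[i]).
Definition v : LaurB := laurentX (laurent rT[i]).
Definition gamma : LaurR := laurentX LaurB.
Definition BtoR : LaurB -> LaurR := @laurentC LaurB.

Section Hecke.
Variable n : nat.
Local Notation T := (@free_gen LaurB 'I_n.-1).

Inductive hecke_rel : set (free_alg LaurB 'I_n.-1) :=
| HeckeFar (i j : 'I_n.-1) : (i.+1 < j)%N ->
    hecke_rel (T i * T j - T j * T i)
| HeckeNear (i j : 'I_n.-1) : i.+1 = j :> nat ->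
    hecke_rel (T i * T j * T i - T j * T i * T j)
| HeckeQuad i : hecke_rel (T i ^+ 2 - ((u ^+ 2)%:A + v *: T i)).

Definition hecke := pres_alg hecke_rel.

Definition heckeT (i : 'I_n.-1) : hecke := gen hecke_rel i.

Definition heckeTw (w : 'S_n) : hecke :=
  (u ^- perm_length w) *: \prod_(i <- reduced_word w) heckeT i.

End Hecke.

Definition hecke_incl n : hecke n -> hecke n.+1 :=
  pres_lift (fun i => @heckeT n.+1 (widen_ord (leq_pred n) i)).

(* The homomorphism H_m -> H_n, T_i |-> T_{k+i}, for m + k <= n. *)
Definition hecke_shift m n (k : nat) : hecke m -> hecke n :=
  pres_lift (fun i : 'I_m.-1 => oapp (@heckeT n) 1 (insub (k + i)%N)).

(* As H_0 = B, the conditions on tau_0 say that it is the identity of B. The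
   last generator T_{n+1} of H_{n+2} is heckeT ord_max. *)
Definition ocneanu_trace (tau : forall n, hecke n -> LaurB) :=
  [/\ forall n, scalar (tau n),
      tau 0%N 1 = 1 /\ tau 1%N 1 = 1,
      forall n (x y : hecke n.+1), tau n.+1 (x * y) = tau n.+1 (y * x)
    & forall n (x : hecke n.+1),
        tau n.+2 (hecke_incl x * @heckeT n.+2 ord_max) = tau n.+1 x /\
        tau n.+2 (hecke_incl x * two_sided_inv (@heckeT n.+2 ord_max))
          = tau n.+1 x].

Section YokonumaHecke.
Variables (d n : nat).
Local Notation I := ('I_n.-1 + 'I_n)%type.
Local Notation g i := (@free_gen LaurB I (inl i)).
Local Notation t j := (@free_gen LaurB I (inr j)).

(* As t_j^d = 1, t_j^{-s} is written t_j^{d-s}. *)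
Definition free_e (i : 'I_n.-1) : free_alg LaurB I :=
  (d%:R^-1) *: \sum_(s < d) t (lo i) ^+ s * t (hi i) ^+ (d - s).

Inductive yh_rel : set (free_alg LaurB I) :=
| YHFar (i j : 'I_n.-1) : (i.+1 < j)%N -> yh_rel (g i * g j - g j * g i)
| YHNear (i j : 'I_n.-1) : i.+1 = j :> nat ->
    yh_rel (g i * g j * g i - g j * g i * g j)
| YHComm (j k : 'I_n) : yh_rel (t j * t k - t k * t j)
| YHPerm (i : 'I_n.-1) (j : 'I_n) : yh_rel (g i * t j - t (adj i j) * g i)
| YHTors (j : 'I_n) : yh_rel (t j ^+ d - 1)
| YHQuad i : yh_rel (g i ^+ 2 - ((u ^+ 2)%:A + v *: (free_e i * g i))).

Definition yh := pres_alg yh_rel.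

Definition yhg (i : 'I_n.-1) : yh := gen yh_rel (inl i).
Definition yht (j : 'I_n) : yh := gen yh_rel (inr j).
Definition yhe (i : 'I_n.-1) : yh := \pi_yh (free_e i).

Definition yhgw (w : 'S_n) : yh :=
  (u ^- perm_length w) *: \prod_(i <- reduced_word w) yhg i.

Definition yhR := base_change BtoR yh_rel.

Variable xi : 'I_d -> rT[i].

Definition E_char (chi : character d n) : yh :=
  \prod_(i < n) ((d%:R^-1 : LaurB) *:
    \sum_(s < d) constB (xi (chi i)) ^+ s *: yht i ^+ (d - s)).

Definition E_comp (mu : comp_type d n) : yh :=
  \sum_(chi : character d n | char_comp chi == mu) E_char chi.

End YokonumaHecke.

Definition yh_incl d n : yh d n -> yh d n.+1 :=
  pres_lift
    (fun x => match x with
              | inl i => @yhg d n.+1 (widen_ord (leq_pred n) i)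
              | inr j => @yht d n.+1 (widen_ord (leqnSn n) j)
              end).

(* Families indexed by n >= 1; the component at n = 0 is ignored. *)
Definition markov_trace d (rho : forall n, yh d n -> LaurB) :=
  [/\ forall n, scalar (rho n.+1),
      forall n (x y : yh d n.+1), rho n.+1 (x * y) = rho n.+1 (y * x)
    & forall n (x : yh d n.+1),
        rho n.+2 (yh_incl x * @yhg d n.+2 ord_max) = rho n.+1 x /\
        rho n.+2 (yh_incl x * two_sided_inv (@yhg d n.+2 ord_max))
          = rho n.+1 x].

Section BasicTraces.
Variables (d : nat) (d_gt0 : (0 < d)%N) (xi : 'I_d -> rT[i]).

Definition subalgebra n (S : set (hecke n)) :=
  [/\ S 1, forall a x y, S x -> S y -> S (a *: x + y)
    & forall x y, S x -> S y -> S (x * y)].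

Definition hecke_young n (mu : comp_type d n) : set (hecke n) :=
  smallest (@subalgebra n) (@heckeT n @` [set i | young d_gt0 mu (adj i)]).

Section Psi.
Variables (n : nat) (mu : comp_type d n).
Variables (p : 'I_(multinomial mu) -> 'S_n).

Definition chi_ (k : 'I_(multinomial mu)) : character d n :=
  perm_char (p k) (char1 d_gt0 mu).

(* Only the values of Psi on E_mu Y_{d,n} are constrained. *)
Definition is_Psi (Psi : yh d n -> 'M[hecke n]_(multinomial mu)) :=
  let EY : set (yh d n) := range (fun y => E_comp xi mu * y) in
  [/\ forall a, {in EY &, forall x y,
        Psi (a *: x + y) = map_mx ( *:%R a) (Psi x) + Psi y},
      {in EY &, {morph Psi : x y / x * y >-> x *m y}},
      Psi (E_comp xi mu) = 1%:M,
      set_bij EY [set M | forall k j, hecke_young mu (M k j)] Psi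
    & forall k j w, perm_char w (chi_ j) = chi_ k ->
        Psi (E_char xi (chi_ k) * yhgw d w) =
        heckeTw (pcomp (p k)^-1%g (pcomp w (p j))) *: delta_mx k j].

End Psi.

Variable tau : forall n, hecke n -> LaurB.

(* tau_{mu_1} (x) ... (x) tau_{mu_d} on H^mu, where x_1 (x) ... (x) x_d is
   identified with the product of the images of the x_a in H^mu. *)
Definition tau_tensor n (mu : comp_type d n) (y : hecke n) : LaurB :=
  xget 0 [set b | exists s : seq {dffun forall a : 'I_d, hecke (mu a)},
    y = \sum_(x <- s) \prod_(a < d) hecke_shift n (block_start mu a) (x a) /\
    b = \sum_(x <- s) \prod_(a < d) tau (x a)].

Variable Psi :
  forall n (mu : comp_type d n), yh d n -> 'M[hecke n]_(multinomial mu).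

Definition basic_trace (mu0 : {ffun 'I_d -> 'I_2}) n (x : yh d n) : LaurB :=
  \sum_(mu in Comp d n | comp_supp mu == mu0)
     tau_tensor mu (\tr (Psi mu (E_comp xi mu * x))).

End BasicTraces.

(** * Link invariants *)

(* The restrictions to B_n of the homomorphisms defined on group algebras. *)
Definition delta_yh d n : braid n -> yhR d n :=
  braid_lift (fun i =>
    (gamma *: (1 : yhR d n) + (1 - gamma) *: to_base_change BtoR (yhe d i))
    * to_base_change BtoR (yhg d i)).

Definition delta_hecke n : braid n -> hecke n := braid_lift (@heckeT n).

(* beta K is a braid, with at least one strand, whose closure is K. *)
Variable beta : classical_link rT -> {n : nat & braid n.+1}.

Definition GammaY d (rho : forall n, yh d n -> LaurB) (K : classical_link rT)
    : LaurR :=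
  extend_scalars (@rho _) (delta_yh d (projT2 (beta K))).

Definition GammaH (tau : forall n, hecke n -> LaurB) (K : classical_link rT)
    : LaurB :=
  tau _ (delta_hecke (projT2 (beta K))).

End Algebras.

(* Main.v *)
Require Import Defs.
From HB Require Import structures.
From mathcomp Require Import all_boot all_order all_algebra all_fingroup.
From mathcomp Require Import fraction generic_quotient complex finmap monalg.
From mathcomp Require Import all_classical all_reals zify.

(** If [mu^0] is concentrated at [a], the only composition [mu] of [n] with
    support [mu^0] has [mu_a = n]; then [Mat_{m_mu}(H^mu)] is [H_n] itself, and
    [x |-> Psi_mu(E_mu x)] is the algebra homomorphism [Y_{d,n} -> H_n] with
    [g_i |-> T_i] and [t_j |-> xi_a].  So [rho_{mu^0,n}] is [tau_n] composed
    with this homomorphism.  It sends every [e_i] to [1], hence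
    [gamma + (1 - gamma) e_i] to [1] and [delta_Y(beta)] to [delta_H(beta)],
    whatever [gamma] is.  As it also commutes with the inclusions
    [Y_{d,n} -> Y_{d,n+1}] and [H_n -> H_{n+1}], it pulls the Ocneanu trace back
    to a Markov trace. *)

Import Order.TTheory GRing.Theory Num.Theory.

Local Open Scope classical_set_scope.
Local Open Scope quotient_scope.
Local Open Scope ring_scope.

Set Implicit Arguments.
Unset Strict Implicit.
Unset Printing Implicit Defensive.

(** Homomorphisms out of presented algebras, scalar extensions of traces and inverses of generators
    are all defined through choices: a representative in a free algebra, or [xget] with a default.
    Much of the work shows that these choices do not matter. A linear map on a free algebra passes
    to the quotient once it kills every relator multiplied by monomials on both sides, and inverses
    are exhibited explicitly before [two_sided_inv] is transported. For the images of the braid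
    generators this rests on the idempotency of [e_i]: [gamma + (1 - gamma) e_i] is invertible
    because [gamma] is.

    The homomorphism to [H_n] is obtained twice: from its values on generators ([yh_to_hecke]), and
    as the single entry of [Psi_mu (E_mu x)] ([Psi_entry]). Multiplicativity of the latter comes
    from [E_mu x E_mu = E_mu x], which is drawn from the injectivity of [Psi_mu]; the two maps are
    then compared on generators. The second half of the theorem works with the first description
    alone. *)

Section LaurentTheory.
Variable A : idomainType.

Fact laurentC_zmod_morphism : zmod_morphism (@laurentC A).
Proof. by move=> a b; apply: val_inj; rewrite /= !rmorphB. Qed.

Fact laurentC_monoid_morphism : monoid_morphism (@laurentC A).
Proof. by split=> [|a b]; apply: val_inj; rewrite /= ?rmorph1 ?rmorphM. Qed.

HB.instance Definition _ :=
  GRing.isZmodMorphism.Build A (laurent A) (@laurentC A) laurentC_zmod_morphism.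
HB.instance Definition _ := GRing.isMonoidMorphism.Build A (laurent A)
  (@laurentC A) laurentC_monoid_morphism.

Lemma laurentX_unit : laurentX A \is a GRing.unit.
Proof.
have Xn0 : @FracField.tofrac {poly A} 'X != 0 by rewrite tofrac_eq0 polyX_eq0.
have XVP : (FracField.tofrac 'X)^-1 \in @laurent_pred A.
  by apply/asboolP; exists 1%N, 1; rewrite expr1 mulVf ?rmorph1.
by apply: (@laurent_unitPl _ _ (Laurent XVP)); apply: val_inj; rewrite /= mulVf.
Qed.

End LaurentTheory.

(** * Linear maps on monoid algebras *)

Definition malg_linear (K : idomainType) (M : choiceType) (V : lmodType K)
    (h : M -> V) (x : {malg K[M]}) : V :=
  \sum_(m <- msupp x) x@_m *: h m.

Section MalgLinear.
Variables (K : idomainType) (M : choiceType) (V : lmodType K) (h : M -> V).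

Lemma malg_linearEw (D : {fset M}) (x : {malg K[M]}) : (msupp x `<=` D)%fset ->
  malg_linear h x = \sum_(m <- D) x@_m *: h m.
Proof.
move=> le; rewrite [LHS](big_fset_incl _ le) //= => m _ /mcoeff_outdom ->.
by rewrite scale0r.
Qed.

Fact malg_linear_is_linear : linear (malg_linear h).
Proof.
move=> a x y.
rewrite (@malg_linearEw (msupp x `|` msupp y)%fset (a *: x + y)); last first.
  apply: fsubset_trans (msuppD_le _ _) _.
  by apply: fsetSU; apply: msuppZ_le.
rewrite (malg_linearEw (fsubsetUl _ (msupp y))).
rewrite (malg_linearEw (fsubsetUr (msupp x) _)).
rewrite scaler_sumr -big_split /=; apply: eq_bigr => m _.
by rewrite mcoeffD mcoeffZ scalerDl scalerA.
Qed.

HB.instance Definition _ := GRing.isLinear.Build K {malg K[M]} V *:%R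
  (malg_linear h) malg_linear_is_linear.

Lemma malg_linearU m : malg_linear h << m >> = h m.
Proof.
by rewrite (malg_linearEw msuppU_le) big_seq_fset1 mcoeffUU scale1r.
Qed.

End MalgLinear.

Lemma malg_ind (K : idomainType) (M : choiceType) (P : {malg K[M]} -> Prop) :
  P 0 -> (forall a m x, P x -> P (a *: << m >> + x)) -> forall x, P x.
Proof.
move=> P0 PD x; rewrite [x]monalgE.
elim: (enum_fset _) => [|m r IH]; rewrite ?big_nil // big_cons.
rewrite (_ : << x@_m *g m >> = x@_m *: << m >>); first exact: PD.
apply/malgP => k; rewrite mcoeffZ !mcoeffU.
by case: (m == k); rewrite ?mulr1 ?mulr0.
Qed.

Lemma linear_fun0 (K : pzRingType) (U V : lmodType K) (f : U -> V) :
  linear f -> f 0 = 0.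
Proof. by move=> /(_ (-1) 0 0); rewrite scaler0 addr0 scaleN1r addNr. Qed.

Lemma linear_funZ (K : pzRingType) (U V : lmodType K) (f : U -> V) a x :
  linear f -> f (a *: x) = a *: f x.
Proof. by move=> fL; have := fL a x 0; rewrite (linear_fun0 fL) !addr0. Qed.

Lemma linear_funD (K : pzRingType) (U V : lmodType K) (f : U -> V) x y :
  linear f -> f (x + y) = f x + f y.
Proof. by move=> /(_ 1 x y); rewrite !scale1r. Qed.

(** Monomials span a monoid algebra, so bilinear identities may be tested on them. This serves both
    for multiplicativity of maps out of a free algebra and for the ideal generated by relators. *)
Lemma malg_bilinear_eq0 (K : idomainType) (M M' : choiceType) (V : lmodType K)
    (beta : {malg K[M]} -> {malg K[M']} -> V) :
    (forall y, linear (beta^~ y)) -> (forall x, linear (beta x)) ->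
    (forall m m', beta << m >> << m' >> = 0) ->
  forall x y, beta x y = 0.
Proof.
move=> betal betar beta0 x y.
elim/malg_ind: x => [|a m x IH]; first exact: (linear_fun0 (betal y)).
rewrite betal {}IH addr0.
elim/malg_ind: y => [|b m' y IH]; first by rewrite (linear_fun0 (betar _)) scaler0.
by rewrite betar beta0 scaler0 add0r.
Qed.

Section SandwichProducts.
Variables (K : nzRingType) (F : lalgType K) (V : lmodType K).
Variable (phi : {linear F -> V}).

Lemma linear_mulr2 y b : linear (fun a => phi (a * y * b)).
Proof. by move=> c a a'; rewrite !mulrDl -!scalerAl linearP. Qed.

Lemma linear_mull2 a y :
  (forall c (x z : F), c *: (x * z) = x * (c *: z)) ->
  linear (fun b => phi (a * y * b)).
Proof. by move=> ZAr c b b'; rewrite mulrDr -ZAr linearP. Qed.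

Lemma sandwichB a b x y :
  phi (a * (x - y) * b) = phi (a * x * b) - phi (a * y * b).
Proof. by rewrite mulrBr mulrBl raddfB. Qed.

Lemma sandwichD a b x y :
  phi (a * (x + y) * b) = phi (a * x * b) + phi (a * y * b).
Proof. by rewrite mulrDr mulrDl raddfD. Qed.

Lemma annihilator_ideal (J := fun x => forall a b, phi (a * x * b) = 0) :
  [/\ J 0, forall x y, J x -> J y -> J (x - y)
    & forall a x b, J x -> J (a * x * b)].
Proof.
split=> [a b|x y Jx Jy a b|a x b Jx a' b'].
- by rewrite mulr0 mul0r raddf0.
- by rewrite sandwichB Jx Jy subr0.
- by rewrite -(Jx (a' * a) (b * b')) !mulrA.
Qed.

End SandwichProducts.

Section MalgAlgebra.
Variables (K : idomainType) (M : monomType).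

Fact malg_scalerAr a (x y : {malg K[M]}) : a *: (x * y) = x * (a *: y).
Proof.
rewrite -(mul_malgC a y) mulrA fgscaleAl; congr (_ * y).
rewrite malgM_def fgmulgU; apply: eq_bigr => m _.
by rewrite mulm1 mulrC.
Qed.

End MalgAlgebra.

(** * Presented algebras and their universal property *)

Section PresentedAlgebraTheory.
Variables (K : idomainType) (I : choiceType) (rel : set (free_alg K I)).
Local Notation Q := (pres_alg rel).

Definition pres_pi (x : free_alg K I) : Q := \pi_Q x.

Fact pres_pi_is_linear : linear pres_pi.
Proof.
move=> a x y; rewrite /pres_pi.
by rewrite -(pres_addE rel (a *: x)) -(pres_scaleE rel a x).
Qed.

Fact pres_pi_is_monoid_morphism : monoid_morphism pres_pi.
Proof. by split=> // x y; rewrite /pres_pi -pres_mulE. Qed.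

HB.instance Definition _ := GRing.isLinear.Build K (free_alg K I) Q *:%R
  pres_pi pres_pi_is_linear.
HB.instance Definition _ := GRing.isMonoidMorphism.Build (free_alg K I) Q
  pres_pi pres_pi_is_monoid_morphism.

Lemma pres_piW (P : Q -> Prop) : (forall x, P (pres_pi x)) -> forall x, P x.
Proof. by move=> Px; elim/quotW. Qed.

Lemma pres_pi_rel x : rel x -> pres_pi x = 0.
Proof.
move=> rx; rewrite -(rmorph0 pres_pi); apply/eqP; rewrite eqquotE.
by apply/asboolP => J [_]; rewrite subr0; apply.
Qed.

Lemma free_monomM (m1 m2 : {fmonom I}) :
  << m1 >> * << m2 >> = << mmul m1 m2 >> :> free_alg K I.
Proof. by rewrite malgM_def fgmulUU mulr1. Qed.

Lemma free_monomE (m : {fmonom I}) :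
  << m >> = \prod_(i <- (m : seq I)) free_gen K i.
Proof.
case: m => s /=; elim: s => [|i s IH].
  by rewrite big_nil; congr << _ >>; apply: val_inj; rewrite /= fm1.
rewrite big_cons -IH free_monomM; congr << _ >>; apply: val_inj.
by rewrite /= fmM /= fmuE.
Qed.

Lemma pres_scalerAl a (x y : Q) : a *: (x * y) = a *: x * y.
Proof.
elim/pres_piW: x => x; elim/pres_piW: y => y.
by rewrite -rmorphM -!linearZ /= -rmorphM scalerAl.
Qed.

Lemma pres_scalerAr a (x y : Q) : a *: (x * y) = x * (a *: y).
Proof.
elim/pres_piW: x => x; elim/pres_piW: y => y.
by rewrite -rmorphM -!linearZ /= -rmorphM malg_scalerAr.
Qed.

Lemma pres_ind (P : Q -> Prop) :
    P 1 -> (forall i, P (gen rel i)) ->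
    (forall a x y, P x -> P y -> P (a *: x + y)) ->
    (forall x y, P x -> P y -> P (x * y)) ->
  forall x, P x.
Proof.
move=> P1 Pgen PD PM; elim/pres_piW => x; elim/malg_ind: x => [|a m x IH].
  by rewrite rmorph0 -(subrr 1) -scaleN1r addrC; apply: PD.
rewrite linearP /=; apply: PD => //; rewrite free_monomE rmorph_prod.
by elim/big_ind: _ => // i _; apply: Pgen.
Qed.

End PresentedAlgebraTheory.

Section RelationIdeal.
Variables (K : idomainType) (I : choiceType) (rel : set (free_alg K I)).
Variables (V : lmodType K) (h : {fmonom I} -> V).
Hypothesis h_rel : forall m1 x m2, rel x ->
  malg_linear h (<< m1 >> * x * << m2 >>) = 0.

(** The elements whose products [a * x * b] are all killed form a two-sided ideal. It contains
    [rel]: by bilinearity the case of monomials [a] and [b], which is [h_rel], is enough. *)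
Lemma malg_linear_rel_ideal x : rel_ideal rel x -> malg_linear h x = 0.
Proof.
move=> xI; rewrite -[x]mul1r -[1 * x]mulr1.
apply: (xI [set x | forall a b, malg_linear h (a * x * b) = 0]) => {x xI}.
split; first exact: (annihilator_ideal (malg_linear h)).
move=> y ry; apply: (malg_bilinear_eq0 (beta := fun a b => _)) => [b|a|m1 m2].
- exact: (linear_mulr2 (malg_linear h)).
- exact: (linear_mull2 (malg_linear h) _ _ (@malg_scalerAr _ _)).
- exact: h_rel.
Qed.

(** Independence of the representative: [pres_lift] and [extend_scalars] both evaluate such a sum at
    [repr], and this lemma lets them be computed at any preimage. *)
Lemma malg_linear_repr x :
  malg_linear h (repr (pres_pi rel x)) = malg_linear h x.
Proof.
apply/eqP; rewrite -subr_eq0 -raddfB /=; apply/eqP/malg_linear_rel_ideal.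
apply/asboolP; rewrite -/(rel_equiv rel _ _) -(eqquotE (pres_alg rel)).
by rewrite reprK.
Qed.

End RelationIdeal.

Section PresLift.
Variables (K : idomainType) (I J : choiceType).
Variables (rel : set (free_alg K I)) (rel' : set (free_alg K J)).
Variable f : I -> pres_alg rel'.

Definition free_lift : free_alg K I -> pres_alg rel' :=
  malg_linear (fun m : {fmonom I} => \prod_(i <- (m : seq I)) f i).

HB.instance Definition _ := GRing.Linear.on free_lift.

Fact free_lift_is_linear : linear free_lift.
Proof. exact: malg_linear_is_linear. Qed.

Fact free_lift_is_monoid_morphism : monoid_morphism free_lift.
Proof.
split=> [|x y]; first by rewrite /free_lift malg_linearU fm1 big_nil.
apply/eqP; rewrite -subr_eq0; apply/eqP.
apply: (malg_bilinear_eq0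
  (beta := fun a b => free_lift (a * b) - free_lift a * free_lift b)) x y.
- move=> b c x y /=; rewrite mulrDl -scalerAl !linearP mulrDl -pres_scalerAl.
  by rewrite scalerBr opprD addrACA.
- move=> b c x y /=; rewrite mulrDr -malg_scalerAr !linearP mulrDr -pres_scalerAr.
  by rewrite scalerBr opprD addrACA.
- move=> m m'; rewrite free_monomM /free_lift !malg_linearU fmM big_cat.
  exact: subrr.
Qed.

HB.instance Definition _ := GRing.isMonoidMorphism.Build (free_alg K I)
  (pres_alg rel') free_lift free_lift_is_monoid_morphism.

Lemma free_lift_gen i : free_lift (free_gen K i) = f i.
Proof. by rewrite /free_lift malg_linearU fmU big_seq1. Qed.

Hypothesis f_rel : forall x, rel x -> free_lift x = 0.

Lemma pres_lift_pi x : pres_lift f (pres_pi rel x) = free_lift x.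
Proof.
apply: malg_linear_repr => m1 y m2 ry; rewrite -/free_lift !rmorphM /=.
by rewrite (f_rel ry) mulr0 mul0r.
Qed.

Lemma pres_lift_is_linear : linear (@pres_lift _ _ _ rel _ f).
Proof.
move=> a; elim/pres_piW => x; elim/pres_piW => y.
by rewrite -linearP !pres_lift_pi linearP.
Qed.

Lemma pres_lift_is_monoid_morphism :
  monoid_morphism (@pres_lift _ _ _ rel _ f).
Proof.
split; first by rewrite -(rmorph1 (pres_pi rel)) pres_lift_pi rmorph1.
elim/pres_piW => x; elim/pres_piW => y.
by rewrite -rmorphM !pres_lift_pi rmorphM.
Qed.

Lemma pres_lift_gen i : pres_lift f (gen rel i) = f i.
Proof. by rewrite -[gen rel i]/(pres_pi rel _) pres_lift_pi free_lift_gen. Qed.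

End PresLift.

(** * Two-sided inverses and extension of scalars *)

Section TwoSidedInverse.

Lemma two_sided_invP (A : pzRingType) (x y : A) :
  x * y = 1 -> y * x = 1 -> two_sided_inv x = y.
Proof.
move=> xy yx; rewrite /two_sided_inv; case: xgetP => [z _ [_ zx]|/(_ y)].
  by rewrite -[z]mulr1 -xy mulrA zx mul1r.
by case.
Qed.

(** An inverse has to be supplied, because [two_sided_inv] takes the default value 0 on elements
    that are not invertible. *)
Lemma two_sided_inv_morph (A B : pzRingType) (phi : A -> B) (x y : A) :
  monoid_morphism phi -> x * y = 1 -> y * x = 1 ->
  phi (two_sided_inv x) = two_sided_inv (phi x).
Proof.
move=> [phi1 phiM] xy yx; rewrite (two_sided_invP xy yx).
by apply/esym/two_sided_invP; rewrite -phiM ?xy ?yx.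
Qed.

End TwoSidedInverse.

Section BaseChangeTheory.
Variables (K L : idomainType) (iota : {rmorphism K -> L}) (I : choiceType).
Variable rel : set (free_alg K I).
Local Notation A := (pres_alg rel).
Local Notation pure := (@to_base_change K L iota I rel).
Local Notation BR := (@base_change_rel K L iota I rel).

Let pure_rel x : base_change_rel iota x ->
  pres_pi (@base_change_rel K L iota I rel) x = 0.
Proof. exact: pres_pi_rel. Qed.

Lemma pureD : {morph pure : a b / a + b}.
Proof.
move=> a b; have := pure_rel (BaseChangeD iota a b).
by rewrite linearB linearD /= => /eqP; rewrite subr_eq0 => /eqP.
Qed.

Lemma pureZ k a : pure (k *: a) = iota k *: pure a.
Proof.
have := pure_rel (BaseChangeZ iota k a).
by rewrite linearB linearZ /= => /eqP; rewrite subr_eq0 => /eqP.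
Qed.

Lemma pure_is_monoid_morphism : monoid_morphism pure.
Proof.
split.
  have := pure_rel (BaseChange1 iota rel).
  by rewrite linearB rmorph1 /= => /eqP; rewrite subr_eq0 => /eqP.
move=> a b; have := pure_rel (BaseChangeM iota a b).
by rewrite linearB rmorphM /= => /eqP; rewrite subr_eq0 => /eqP.
Qed.

Section ExtendScalars.
Variable f : A -> K.
Hypothesis f_scalar : scalar f.

Let h (m : {fmonom A}) : L^o := iota (f (\prod_(a <- (m : seq A)) a)).

Let f0 : f 0 = 0.
Proof. by have := f_scalar (-1) 0 0; rewrite scaler0 addr0 mulN1r addNr. Qed.
Let fZ k x : f (k *: x) = k * f x.
Proof. by have := f_scalar k x 0; rewrite f0 !addr0. Qed.
Let fD : {morph f : x y / x + y}.
Proof. by move=> x y; have := f_scalar 1 x y; rewrite scale1r mul1r. Qed.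

(** Between two monomials with products [p1] and [p2] in [A], the element [pure a] contributes
    [iota (f (p1 * a * p2))]. Each relator is therefore killed by the linearity of [f] or by the
    ring laws of [A]. *)
Lemma extend_scalars_pi x :
  @extend_scalars K L iota I rel f (pres_pi BR x) = malg_linear h x.
Proof.
transitivity (malg_linear h (repr (pres_pi BR x))); first by [].
apply: (@malg_linear_repr L A BR L^o h) => m1 w m2 w_rel.
pose psi (y : free_alg L A) : L := malg_linear h (<< m1 >> * y * << m2 >>).
pose p1 : A := \prod_(b <- (m1 : seq A)) b.
pose p2 : A := \prod_(b <- (m2 : seq A)) b.
have psiB y z : psi (y - z) = psi y - psi z.
  exact: (sandwichB (malg_linear h)).
have psiD y z : psi (y + z) = psi y + psi z.
  exact: (sandwichD (malg_linear h)).
have psiZ c y : psi (c *: y) = c * psi y.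
  rewrite /psi -malg_scalerAr.
  by rewrite -fgscaleAl linearZ.
have psi1 : psi 1 = iota (f (p1 * p2)).
  by rewrite /psi mulr1 free_monomM malg_linearU /h fmM big_cat.
have psig a : psi (free_gen L a) = iota (f (p1 * a * p2)).
  rewrite /psi /free_gen !free_monomM malg_linearU /h.
  by rewrite !fmM fmU !big_cat big_seq1.
have psigM a b :
    psi (free_gen L a * free_gen L b) = iota (f (p1 * (a * b) * p2)).
  rewrite /psi /free_gen !free_monomM malg_linearU /h.
  by rewrite !fmM !fmU !big_cat !big_seq1 /= !mulrA.
rewrite -/(psi w); case: w_rel => [a b|a b||k a]; rewrite psiB.
- by rewrite psiD !psig mulrDr mulrDl fD rmorphD subrr.
- by rewrite psig psigM subrr.
- by rewrite psi1 psig mulr1 subrr.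
- by rewrite psiZ !psig -pres_scalerAr -pres_scalerAl fZ rmorphM /= subrr.
Qed.

Lemma extend_scalars_is_scalar : scalar (@extend_scalars K L iota I rel f).
Proof.
move=> a; elim/pres_piW => x; elim/pres_piW => y.
by rewrite -linearP !extend_scalars_pi linearP.
Qed.

Lemma extend_scalars_pure a :
  @extend_scalars K L iota I rel f (pure a) = iota (f a).
Proof.
rewrite -[pure a]/(pres_pi _ _) extend_scalars_pi malg_linearU.
by rewrite /h fmU big_seq1.
Qed.

End ExtendScalars.
End BaseChangeTheory.

(** * Averages over the cyclic group of order d, and idempotents *)

Lemma sum_ord_shift (V : zmodType) d (F : nat -> V) :
  F 0%N = F d -> \sum_(s < d) F s = \sum_(s < d) F s.+1.
Proof.
move=> F0d; apply: (@addrI _ (F 0%N)).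
rewrite -(big_ord_recl d (fun s : 'I_d.+1 => F s)).
by rewrite big_ord_recr /= F0d addrC.
Qed.

Section TorsionSum.
Variables (Q : pzRingType) (d : nat) (a b : Q).
Hypotheses (ad : a ^+ d = 1) (bd : b ^+ d = 1) (ab : GRing.comm a b).
Local Notation S := (\sum_(s < d) a ^+ s * b ^+ (d - s)).

(** [S] is [d] times the projector onto the part where [a] and [b] coincide: both multiplications
    shift the exponents cyclically, and the wrap-around is harmless since [a ^+ d = b ^+ d]. *)
Lemma torsion_sumM : S * a = S * b.
Proof.
(* [F s] is the s-th term of [S * b], and [F s.+1] that of [S * a]; moreover [F 0] and [F d] both
   equal [b]. *)
rewrite !mulr_suml; pose F s := a ^+ s * b ^+ (d.+1 - s).
rewrite (eq_bigr (fun s : 'I_d => F s.+1)); last first.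
  by move=> s _; rewrite /F subSS exprSr -!mulrA (commrX _ ab).
rewrite -(@sum_ord_shift _ _ F); last first.
  by rewrite /F subn0 subSn // subnn ad mul1r expr1 expr0 mul1r exprS bd mulr1.
by apply: eq_bigr => s _; rewrite /F subSn ?exprSr ?mulrA // ltnW.
Qed.

Lemma torsion_sumX s : S * a ^+ s = S * b ^+ s.
Proof.
elim: s => [|s IH]; first by rewrite !expr0.
rewrite [in LHS]exprS mulrA torsion_sumM -mulrA (commrX s (commr_sym ab)) mulrA.
by rewrite IH -mulrA -exprSr.
Qed.

Lemma torsion_sum_sqr : S * S = S *+ d.
Proof.
rewrite [LHS]mulr_sumr (eq_bigr (fun=> S)) => [|s _].
  by rewrite sumr_const card_ord.
by rewrite mulrA torsion_sumX -mulrA -exprD subnKC ?bd ?mulr1 // ltnW.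
Qed.

Lemma torsion_sumC : S = \sum_(s < d) b ^+ s * a ^+ (d - s).
Proof.
rewrite (@sum_ord_shift _ _ (fun s => a ^+ s * b ^+ (d - s))); last first.
  by rewrite subn0 subnn ad bd !expr0 mulr1.
rewrite (reindex_inj rev_ord_inj); apply: eq_bigr => s _ /=.
rewrite -subSn // subSS; have -> : (d - (d - s) = s)%N by rewrite subKn // ltnW.
by apply: commrX; apply/commr_sym/commrX.
Qed.

End TorsionSum.

Lemma mulr_inverses (Q : pzRingType) (x x' y y' : Q) :
  x * x' = 1 -> y * y' = 1 -> x * y * (y' * x') = 1.
Proof. by move=> xx' yy'; rewrite mulrA -(mulrA x) yy' mulr1. Qed.

Lemma commr_intertwineX (Q : pzRingType) (g a b : Q) s :
  g * a = b * g -> g * a ^+ s = b ^+ s * g.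
Proof.
move=> ga; elim: s => [|s IH]; first by rewrite !expr0 mulr1 mul1r.
by rewrite exprS mulrA ga -mulrA IH mulrA -exprS.
Qed.

Section PresScalars.
Variables (K : idomainType) (I : choiceType) (rel : set (free_alg K I)).
Local Notation Q := (pres_alg rel).

Lemma pres_mulZl (a : K) (x : Q) : (a *: (1 : Q)) * x = a *: x.
Proof. by rewrite -pres_scalerAl mul1r. Qed.

Lemma pres_mulZr (a : K) (x : Q) : x * (a *: (1 : Q)) = a *: x.
Proof. by rewrite -pres_scalerAr mulr1. Qed.

Lemma pres_exprZ1 (a : K) n : (a *: (1 : Q)) ^+ n = a ^+ n *: (1 : Q).
Proof.
elim: n => [|n IH]; first by rewrite !expr0 scale1r.
rewrite [LHS]exprS IH pres_mulZl scalerA.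
exact: (congr1 (fun c => c *: (1 : Q)) (esym (exprS a n))).
Qed.

(** The element is [c (1 - e) + e]: it acts as [c] on the part cut out by [1 - e] and as 1 on the
    part cut out by [e], hence is multiplicative in [c]. *)
Lemma idempotent_combM (c c' : K) (e : Q) : e * e = e -> c * c' = 1 ->
  (c *: (1 : Q) + (1 - c) *: e) * (c' *: (1 : Q) + (1 - c') *: e) = 1.
Proof.
move=> ee cc'.
have eE : e * (c' *: (1 : Q) + (1 - c') *: e) = e.
  rewrite mulrDr pres_mulZr -(pres_scalerAr _ e e) ee -scalerDl.
  by rewrite addrC subrK scale1r.
rewrite mulrDl pres_mulZl -(pres_scalerAl _ e) eE scalerDr !scalerA cc' scale1r.
rewrite -addrA -scalerDl mulrBr cc' mulr1.
by rewrite addrA subrK subrr scale0r addr0.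
Qed.

End PresScalars.

(* Stated for abstract elements: with concrete generators, unification would
   compute products in the monoid algebra. *)
Section RelatorImages.
Variables (K : idomainType) (J : choiceType) (rel : set (free_alg K J)).
Local Notation Q := (pres_alg rel).
Variables (F : lalgType K) (phi : F -> Q).
Hypotheses (phi_linear : linear phi) (phi_monoid : monoid_morphism phi).

Let phi1 : phi 1 = 1 := phi_monoid.1.
Let phiM x y : phi (x * y) = phi x * phi y := phi_monoid.2 x y.
Let phiD x y : phi (x + y) = phi x + phi y := linear_funD x y phi_linear.
Let phi0 : phi 0 = 0 := linear_fun0 phi_linear.
Let phiZ a x : phi (a *: x) = a *: phi x := linear_funZ a x phi_linear.
Let phiB x y : phi (x - y) = phi x - phi y.
Proof. by rewrite -scaleN1r phiD phiZ scaleN1r. Qed.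
Let phiX x m : phi (x ^+ m) = phi x ^+ m.
Proof. by elim: m => [|m IH]; rewrite ?expr0 // !exprS phiM IH. Qed.

Lemma relator_comm x y z w :
  phi (x * y - z * w) = phi x * phi y - phi z * phi w.
Proof. by rewrite phiB !phiM. Qed.

Lemma relator_braid x y z x' y' z' :
  phi (x * y * z - x' * y' * z') =
  phi x * phi y * phi z - phi x' * phi y' * phi z'.
Proof. by rewrite phiB !phiM. Qed.

Lemma relator_torsion x m : phi (x ^+ m - 1) = phi x ^+ m - 1.
Proof. by rewrite phiB phiX phi1. Qed.

Lemma relator_quad x y a b :
  phi (x ^+ 2 - (a%:A + b *: y)) = phi x ^+ 2 - (a *: (1 : Q) + b *: phi y).
Proof. by rewrite phiB phiX phiD !phiZ phi1. Qed.

Lemma image_average a m (x y : F) :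
  phi (a *: \sum_(s < m) x ^+ s * y ^+ (m - s)) =
  a *: \sum_(s < m) phi x ^+ s * phi y ^+ (m - s).
Proof.
rewrite phiZ; congr (_ *: _); rewrite (big_morph phi phiD phi0).
by apply: eq_bigr => s _; rewrite phiM !phiX.
Qed.

End RelatorImages.

(** * Scalar extension of a homomorphism *)

Section BaseChangeMap.
Variables (K L : idomainType) (iota : {rmorphism K -> L}) (I J : choiceType).
Variables (rel : set (free_alg K I)) (rel' : set (free_alg K J)).
Local Notation A := (pres_alg rel).
Local Notation A' := (pres_alg rel').
Local Notation pure := (@to_base_change K L iota I rel).
Local Notation pure' := (@to_base_change K L iota J rel').

(** A product of pure elements is again pure, so the pure elements span the extended algebra over
    [L]. *)
Lemma base_change_ext (f g : base_change iota rel -> L) :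
  scalar f -> scalar g -> (forall a, f (pure a) = g (pure a)) -> f =1 g.
Proof.
move=> fP gP fg; elim/pres_piW => x; elim/malg_ind: x => [|c m x IH].
  by rewrite rmorph0 -(subrr (pure 0)) -scaleN1r addrC fP gP fg.
rewrite linearP /= fP gP IH; congr (c * _ + _).
have [pure1 pureM] := pure_is_monoid_morphism iota rel.
by rewrite free_monomE rmorph_prod /= -(big_morph pure pureM pure1) fg.
Qed.

Variable phi : A -> A'.
Hypothesis phi_linear : linear phi.
Hypothesis phi_monoid_morphism : monoid_morphism phi.

Definition base_change_map : base_change iota rel -> base_change iota rel' :=
  pres_lift (fun a => pure' (phi a)).

Lemma base_change_map_rel x :
  base_change_rel iota x -> free_lift (fun a => pure' (phi a)) x = 0.
Proof.
have [phi1 phiM] := phi_monoid_morphism.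
have [pure1 pureM] := pure_is_monoid_morphism iota rel'.
case=> [a b|a b||k a].
- rewrite linearB linearD /= !free_lift_gen.
  by rewrite (linear_funD a b phi_linear) pureD subrr.
- by rewrite linearB rmorphM /= !free_lift_gen phiM pureM subrr.
- by rewrite linearB rmorph1 /= free_lift_gen phi1 pure1 subrr.
- rewrite linearB linearZ /= !free_lift_gen -pureZ.
  by rewrite (linear_funZ k a phi_linear) subrr.
Qed.

Lemma base_change_map_pure a : base_change_map (pure a) = pure' (phi a).
Proof.
by rewrite /base_change_map pres_lift_gen //; exact: base_change_map_rel.
Qed.

Lemma base_change_map_is_linear : linear base_change_map.
Proof. exact: pres_lift_is_linear base_change_map_rel. Qed.

Lemma base_change_map_is_monoid_morphism : monoid_morphism base_change_map.
Proof. exact: pres_lift_is_monoid_morphism base_change_map_rel. Qed.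

Lemma extend_scalars_map (f : A' -> K) x : scalar f ->
  @extend_scalars K L iota _ _ f (base_change_map x) =
  @extend_scalars K L iota _ _ (f \o phi) x.
Proof.
move=> fP.
have fphiP : scalar (f \o phi) by move=> c a b; rewrite /= phi_linear fP.
suff: (fun y => @extend_scalars K L iota _ _ f (base_change_map y)) =1
  @extend_scalars K L iota _ _ (f \o phi) by exact.
apply: base_change_ext => [c y z||a].
- by rewrite /= base_change_map_is_linear (extend_scalars_is_scalar fP).
- exact: extend_scalars_is_scalar.
- by rewrite base_change_map_pure !extend_scalars_pure.
Qed.

End BaseChangeMap.

HB.instance Definition _ (rT : realType) := GRing.RMorphism.copy (@constB rT)
  (@laurentC _ \o @laurentC _).
HB.instance Definition _ (rT : realType) := GRing.RMorphism.copy (@BtoR rT)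
  (@laurentC _).

Section Units.
Variable rT : realType.

Lemma u_unit : u rT \is a GRing.unit.
Proof. exact: (rmorph_unit (@laurentC _) (laurentX_unit _)). Qed.

Lemma natrB_unit d : (0 < d)%N -> (d%:R : LaurB rT) \is a GRing.unit.
Proof.
move=> d_gt0; rewrite -(rmorph_nat (@constB rT)); apply: rmorph_unit.
by rewrite unitfE pnatr_eq0 -lt0n.
Qed.

End Units.

Lemma average_const (K : unitRingType) (V : lmodType K) (x : V) m :
  (m%:R : K) \is a GRing.unit -> m%:R^-1 *: (x *+ m) = x.
Proof. by move=> mU; rewrite -scaler_nat scalerA mulVr ?scale1r. Qed.

(** * Relations and invertibility of the generators *)

Section HeckeRelations.
Variables (rT : realType) (n : nat).
Local Notation T := (@heckeT rT n).
Local Notation Q := (hecke rT n).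

Let piL := @pres_pi_is_linear (LaurB rT) _ (@hecke_rel rT n).
Let piM := @pres_pi_is_monoid_morphism (LaurB rT) _ (@hecke_rel rT n).

Lemma hecke_far (i j : 'I_n.-1) : (i.+1 < j)%N -> T i * T j = T j * T i.
Proof.
move=> ij; have := pres_pi_rel (HeckeFar rT ij).
by rewrite (relator_comm piL piM) => /subr0_eq.
Qed.

Lemma hecke_near (i j : 'I_n.-1) : i.+1 = j :> nat ->
  T i * T j * T i = T j * T i * T j.
Proof.
move=> ij; have := pres_pi_rel (HeckeNear rT ij).
by rewrite (relator_braid piL piM) => /subr0_eq.
Qed.

Lemma hecke_quad (i : 'I_n.-1) : T i ^+ 2 = u rT ^+ 2 *: (1 : Q) + v rT *: T i.
Proof.
have := pres_pi_rel (HeckeQuad rT i).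
by rewrite (relator_quad piL piM) => /subr0_eq.
Qed.

End HeckeRelations.

Section YokonumaHeckeRelations.
Variables (rT : realType) (d n : nat).
Local Notation g := (@yhg rT d n).
Local Notation t := (@yht rT d n).
Local Notation e := (@yhe rT d n).
Local Notation Q := (yh rT d n).

Let piL := @pres_pi_is_linear (LaurB rT) _ (@yh_rel rT d n).
Let piM := @pres_pi_is_monoid_morphism (LaurB rT) _ (@yh_rel rT d n).

Lemma yh_far (i j : 'I_n.-1) : (i.+1 < j)%N -> g i * g j = g j * g i.
Proof.
move=> ij; have := pres_pi_rel (YHFar rT d ij).
by rewrite (relator_comm piL piM) => /subr0_eq.
Qed.

Lemma yh_near (i j : 'I_n.-1) : i.+1 = j :> nat ->
  g i * g j * g i = g j * g i * g j.
Proof.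
move=> ij; have := pres_pi_rel (YHNear rT d ij).
by rewrite (relator_braid piL piM) => /subr0_eq.
Qed.

Lemma yh_comm j k : GRing.comm (t j) (t k).
Proof.
have := pres_pi_rel (YHComm rT d j k).
by rewrite (relator_comm piL piM) => /subr0_eq.
Qed.

Lemma yh_perm i j : g i * t j = t (adj i j) * g i.
Proof.
have := pres_pi_rel (YHPerm rT d i j).
by rewrite (relator_comm piL piM) => /subr0_eq.
Qed.

Lemma yh_tors j : t j ^+ d = 1.
Proof.
have := pres_pi_rel (YHTors rT d j).
by rewrite (relator_torsion piL piM) => /subr0_eq.
Qed.

Lemma yh_quad i : g i ^+ 2 = u rT ^+ 2 *: (1 : Q) + v rT *: (e i * g i).
Proof.
have := pres_pi_rel (YHQuad rT d i).
by rewrite (relator_quad piL piM) piM.2 => /subr0_eq.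
Qed.

Lemma yheE i :
  e i = d%:R^-1 *: \sum_(s < d) t (lo i) ^+ s * t (hi i) ^+ (d - s).
Proof. exact: (image_average piL piM). Qed.

(** Moving [g_i] across [e_i] exchanges [t_i] and [t_{i+1}], and [torsion_sumC] says that [e_i] is
    symmetric in the two. *)
Lemma yhe_comm i : GRing.comm (e i) (g i).
Proof.
rewrite /GRing.comm yheE -pres_scalerAl -pres_scalerAr; congr (_ *: _).
rewrite [in RHS](torsion_sumC (yh_tors _) (yh_tors _) (yh_comm _ _)).
rewrite mulr_suml mulr_sumr; apply: eq_bigr => s _.
have lohi : g i * t (lo i) = t (hi i) * g i by rewrite yh_perm tpermL.
have hilo : g i * t (hi i) = t (lo i) * g i by rewrite yh_perm tpermR.
rewrite [RHS]mulrA (commr_intertwineX s hilo) -[RHS]mulrA.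
by rewrite (commr_intertwineX (d - s) lohi) mulrA.
Qed.

Hypothesis d_gt0 : (0 < d)%N.

Lemma yhe_idem i : e i * e i = e i.
Proof.
rewrite yheE -pres_scalerAl -pres_scalerAr.
rewrite (torsion_sum_sqr (yh_tors _) (yh_tors _) (yh_comm _ _)).
by rewrite (average_const _ (natrB_unit rT d_gt0)).
Qed.

Lemma yhg_inv i : exists y, g i * y = 1 /\ y * g i = 1.
Proof.
(* The quadratic relation reads [g_i (g_i - v e_i) = u^2]. *)
exists (u rT ^- 2 *: (g i - v rT *: e i)).
rewrite -(pres_scalerAr _ (g i)) -(pres_scalerAl _ _ (g i)) mulrBr mulrBl.
rewrite -(pres_scalerAr _ (g i)) -(pres_scalerAl _ (e i)) yhe_comm.
have -> : g i * g i - v rT *: (g i * e i) = u rT ^+ 2 *: (1 : Q).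
  by rewrite -yhe_comm -expr2 yh_quad addrK.
by rewrite scalerA mulVr ?scale1r // unitrX ?u_unit.
Qed.

End YokonumaHeckeRelations.

(** * Specialization of the framing generators to a root of unity *)

Section Specialization.
Variables (rT : realType) (d n : nat) (zeta : rT[i]).
Hypotheses (d_gt0 : (0 < d)%N) (zeta_root : zeta ^+ d = 1).
Local Notation Q := (hecke rT n).

Definition yh_gen_to_hecke (x : 'I_n.-1 + 'I_n) : Q :=
  match x with inl i => heckeT rT i | inr _ => constB zeta *: (1 : Q) end.

Definition yh_to_hecke : yh rT d n -> Q := pres_lift yh_gen_to_hecke.

Let fL : linear (free_lift yh_gen_to_hecke) := @free_lift_is_linear _ _ _ _ _.
Let fM := free_lift_is_monoid_morphism yh_gen_to_hecke.
Let fE x :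
  free_lift yh_gen_to_hecke (free_gen (LaurB rT) x) = yh_gen_to_hecke x.
Proof. exact: free_lift_gen. Qed.

Lemma constB_root : constB zeta ^+ d = 1.
Proof. by rewrite -rmorphXn zeta_root rmorph1. Qed.

(** Each of the [d] summands becomes [zeta^s zeta^(d-s) = 1]. This is also what turns the quadratic
    relation of [Y_{d,n}] into that of [H_n]. *)
Lemma free_lift_e i : free_lift yh_gen_to_hecke (free_e rT d i) = 1.
Proof.
rewrite (image_average fL fM) !fE /=.
rewrite (eq_bigr (fun=> 1 : Q)) => [|s _].
  by rewrite sumr_const card_ord (average_const _ (natrB_unit rT d_gt0)).
rewrite !pres_exprZ1 pres_mulZl scalerA -exprD subnKC 1?ltnW //.
by rewrite constB_root scale1r.
Qed.

Lemma yh_gen_to_hecke_rel x :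
  yh_rel d x -> free_lift yh_gen_to_hecke x = 0.
Proof.
case=> {x} [i j ij|i j ij|j k|i j|j|i].
- by rewrite (relator_comm fL fM) !fE /= (hecke_far rT ij) subrr.
- by rewrite (relator_braid fL fM) !fE /= (hecke_near rT ij) subrr.
- by rewrite (relator_comm fL fM) !fE /= subrr.
- by rewrite (relator_comm fL fM) !fE /= pres_mulZl pres_mulZr subrr.
- rewrite (relator_torsion fL fM) fE /= pres_exprZ1 constB_root.
  by rewrite scale1r subrr.
- rewrite (relator_quad fL fM) fM.2 free_lift_e mul1r fE /=.
  by rewrite hecke_quad subrr.
Qed.

Lemma yh_to_hecke_linear : linear yh_to_hecke.
Proof. exact: pres_lift_is_linear yh_gen_to_hecke_rel. Qed.

Lemma yh_to_hecke_monoid_morphism : monoid_morphism yh_to_hecke.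
Proof. exact: pres_lift_is_monoid_morphism yh_gen_to_hecke_rel. Qed.

Lemma yh_to_hecke_g i : yh_to_hecke (yhg rT d i) = heckeT rT i.
Proof. exact: (pres_lift_gen yh_gen_to_hecke_rel (inl i)). Qed.

Lemma heckeT_inv (i : 'I_n.-1) :
  exists y, heckeT rT i * y = 1 /\ y * heckeT rT i = 1.
Proof.
have [G1 GM] := yh_to_hecke_monoid_morphism.
have [y [gy yg]] := yhg_inv rT d i.
exists (yh_to_hecke y); rewrite -(yh_to_hecke_g i); split.
  by rewrite -(GM _ y) gy G1.
by rewrite -(GM y) yg G1.
Qed.

Lemma yh_to_hecke_t j : yh_to_hecke (yht rT d j) = constB zeta *: (1 : Q).
Proof. exact: (pres_lift_gen yh_gen_to_hecke_rel (inr j)). Qed.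

Lemma yh_to_hecke_e i : yh_to_hecke (yhe rT d i) = 1.
Proof.
by rewrite -[LHS](esym (pres_lift_pi yh_gen_to_hecke_rel _)) free_lift_e.
Qed.

Local Notation H := (@base_change_map _ _ (@BtoR rT) _ _ _ _ yh_to_hecke).
Local Notation pureY := (to_base_change (@BtoR rT) (rel:=@yh_rel rT d n)).
Local Notation pureH := (to_base_change (@BtoR rT) (rel:=@hecke_rel rT n)).
Local Notation sigma i := ((gamma rT *: (1 : yhR rT d n)
  + (1 - gamma rT) *: pureY (yhe rT d i)) * pureY (yhg rT d i)).

(** The factor [gamma + (1 - gamma) e_i] is inverted by replacing [gamma] with its inverse, since
    [e_i] is idempotent. Without this, [braid_lift] could send inverse letters to the default 0. *)
Lemma sigma_inv i : exists y, sigma i * y = 1 /\ y * sigma i = 1.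
Proof.
have [pure1 pureM] := pure_is_monoid_morphism (@BtoR rT) (@yh_rel rT d n).
have [y [gy yg]] := yhg_inv rT d i.
have gammaU := laurentX_unit (LaurB rT).
have ee : pureY (yhe rT d i) * pureY (yhe rT d i) = pureY (yhe rT d i).
  by rewrite -pureM yhe_idem.
have gG : pureY (yhg rT d i) * pureY y = 1 by rewrite -pureM gy.
have Gg : pureY y * pureY (yhg rT d i) = 1 by rewrite -pureM yg.
have e1 := idempotent_combM ee (mulrV gammaU).
have e2 := idempotent_combM ee (mulVr gammaU).
exists (pureY y * ((gamma rT)^-1 *: (1 : yhR rT d n)
  + (1 - (gamma rT)^-1) *: pureY (yhe rT d i))).
by split; [exact: (mulr_inverses e1 gG) | exact: (mulr_inverses Gg e2)].
Qed.

Lemma base_change_sigma i : H (sigma i) = pureH (heckeT rT i).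
Proof.
have [H1 HM] := base_change_map_is_monoid_morphism (@BtoR rT)
  yh_to_hecke_linear yh_to_hecke_monoid_morphism.
have HL : linear H.
  exact: base_change_map_is_linear yh_to_hecke_linear yh_to_hecke_monoid_morphism.
have HE a : H (pureY a) = pureH (yh_to_hecke a).
  exact: base_change_map_pure yh_to_hecke_linear yh_to_hecke_monoid_morphism _.
have [pureH1 _] := pure_is_monoid_morphism (@BtoR rT) (@hecke_rel rT n).
rewrite HM HE yh_to_hecke_g HL (linear_funZ _ _ HL) H1 HE yh_to_hecke_e pureH1.
by rewrite -scalerDl addrC subrK scale1r mul1r.
Qed.

(** Both sides are products over the same representing word of [b], so they are compared letter by
    letter. *)
Lemma base_change_braid_image (b : braid n) :
  H (delta_yh rT d b) = pureH (delta_hecke rT b).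
Proof.
have HM := base_change_map_is_monoid_morphism (@BtoR rT)
  yh_to_hecke_linear yh_to_hecke_monoid_morphism.
have pureM := pure_is_monoid_morphism (@BtoR rT) (@hecke_rel rT n).
rewrite /delta_yh /delta_hecke /braid_lift.
rewrite (big_morph _ HM.2 HM.1) (big_morph _ pureM.2 pureM.1).
apply: eq_bigr => -[i []] _ /=; first exact: base_change_sigma.
have [y [sy ys]] := sigma_inv i.
rewrite (two_sided_inv_morph HM sy ys) base_change_sigma.
have [z [Tz zT]] := heckeT_inv i.
by rewrite (two_sided_inv_morph pureM Tz zT).
Qed.

End Specialization.

Lemma pres_morph_ext (K : idomainType) (I J : choiceType)
    (rel : set (free_alg K I)) (rel' : set (free_alg K J))
    (f h : pres_alg rel -> pres_alg rel') :
  linear f -> monoid_morphism f -> linear h -> monoid_morphism h ->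
  (forall i, f (gen rel i) = h (gen rel i)) -> f =1 h.
Proof.
move=> fL [f1 fM] hL [h1 hM] fh; elim/pres_ind => [|//|a x y xE yE|x y xE yE].
- by rewrite f1 h1.
- by rewrite fL hL xE yE.
- by rewrite fM hM xE yE.
Qed.

(** * The inclusions that add one strand *)

Section HeckeInclusion.
Variables (rT : realType) (n : nat).
Local Notation wd := (widen_ord (leq_pred n)).

Let f := fun i : 'I_n.-1 => @heckeT rT n.+1 (wd i).
Let fL : linear (free_lift f) := @free_lift_is_linear _ _ _ _ _.
Let fM := free_lift_is_monoid_morphism f.
Let fE i : free_lift f (free_gen (LaurB rT) i) = f i.
Proof. exact: free_lift_gen. Qed.

Lemma hecke_incl_rel x : hecke_rel x -> free_lift f x = 0.
Proof.
case=> {x} [i j ij|i j ij|i].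
- by rewrite (relator_comm fL fM) !fE /f
    (@hecke_far rT n.+1 (wd i) (wd j) ij) subrr.
- by rewrite (relator_braid fL fM) !fE /f
    (@hecke_near rT n.+1 (wd i) (wd j) ij) subrr.
- by rewrite (relator_quad fL fM) fE /f hecke_quad subrr.
Qed.

Lemma hecke_incl_linear : linear (@hecke_incl rT n).
Proof. exact: pres_lift_is_linear hecke_incl_rel. Qed.

Lemma hecke_incl_monoid_morphism : monoid_morphism (@hecke_incl rT n).
Proof. exact: pres_lift_is_monoid_morphism hecke_incl_rel. Qed.

Lemma hecke_incl_gen i : hecke_incl (heckeT rT i) = @heckeT rT n.+1 (wd i).
Proof. exact: (pres_lift_gen hecke_incl_rel). Qed.

End HeckeInclusion.

Section YHInclusion.
Variables (rT : realType) (d n : nat).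
Local Notation wd := (widen_ord (leq_pred n)).
Local Notation wd' := (widen_ord (leqnSn n)).
Local Notation I := ('I_n.-1 + 'I_n)%type.

Let f : I -> yh rT d n.+1 := fun x => match x with
  | inl i => @yhg rT d n.+1 (wd i) | inr j => @yht rT d n.+1 (wd' j) end.
Let fL : linear (free_lift f) := @free_lift_is_linear _ _ _ _ _.
Let fM := free_lift_is_monoid_morphism f.
Let fE i : free_lift f (free_gen (LaurB rT) i) = f i.
Proof. exact: free_lift_gen. Qed.

Lemma adj_widen (i : 'I_n.-1) j : @adj n.+1 (wd i) (wd' j) = wd' (adj i j).
Proof.
have lwd : @lo n.+1 (wd i) = wd' (lo i) by apply: val_inj.
have hwd : @hi n.+1 (wd i) = wd' (hi i) by apply: val_inj.
have wd_inj : injective wd' by move=> k l /(congr1 val) /= /val_inj.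
rewrite /adj lwd hwd.
have [->|->|/eqP jl /eqP jh] := tpermP (lo i) (hi i) j;
  rewrite ?tpermL ?tpermR //.
by rewrite tpermD // inj_eq // eq_sym.
Qed.

Lemma free_lift_incl_e i : free_lift f (free_e rT d i) = @yhe rT d n.+1 (wd i).
Proof.
rewrite (image_average fL fM) !fE /= yheE.
have -> : wd' (lo i) = @lo n.+1 (wd i) by apply: val_inj.
by have -> : wd' (hi i) = @hi n.+1 (wd i) by apply: val_inj.
Qed.

Lemma yh_incl_rel x : yh_rel d x -> free_lift f x = 0.
Proof.
case=> {x} [i j ij|i j ij|j k|i j|j|i].
- by rewrite (relator_comm fL fM) !fE /f /=
    (@yh_far rT d n.+1 (wd i) (wd j) ij) subrr.
- by rewrite (relator_braid fL fM) !fE /f /=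
    (@yh_near rT d n.+1 (wd i) (wd j) ij) subrr.
- by rewrite (relator_comm fL fM) !fE /f /=
    (yh_comm rT d (wd' j) (wd' k)) subrr.
- by rewrite (relator_comm fL fM) !fE /f /= -adj_widen
    (@yh_perm rT d n.+1 (wd i)) subrr.
- by rewrite (relator_torsion fL fM) fE /f /= (yh_tors rT d (wd' j)) subrr.
- by rewrite (relator_quad fL fM) fM.2 free_lift_incl_e fE /f /=
    (@yh_quad rT d n.+1 (wd i)) subrr.
Qed.

Lemma yh_incl_linear : linear (@yh_incl rT d n).
Proof. exact: pres_lift_is_linear yh_incl_rel. Qed.

Lemma yh_incl_monoid_morphism : monoid_morphism (@yh_incl rT d n).
Proof. exact: pres_lift_is_monoid_morphism yh_incl_rel. Qed.

Lemma yh_incl_g i : yh_incl (yhg rT d i) = @yhg rT d n.+1 (wd i).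
Proof. exact: (pres_lift_gen yh_incl_rel (inl i)). Qed.

Lemma yh_incl_t j : yh_incl (yht rT d j) = @yht rT d n.+1 (wd' j).
Proof. exact: (pres_lift_gen yh_incl_rel (inr j)). Qed.

End YHInclusion.

(** * Pulling back the Ocneanu trace *)

Section PulledBackTrace.
Variables (rT : realType) (d : nat) (zeta : rT[i]).
Hypotheses (d_gt0 : (0 < d)%N) (zeta_root : zeta ^+ d = 1).
Variable tau : forall n, hecke rT n -> LaurB rT.
Hypothesis tauP : ocneanu_trace tau.
Local Notation G n := (@yh_to_hecke rT d n zeta).

Let GL n : linear (G n) := yh_to_hecke_linear d_gt0 zeta_root.
Let GM n : monoid_morphism (G n) :=
  yh_to_hecke_monoid_morphism n d_gt0 zeta_root.

Lemma yh_to_hecke_incl n x : G n.+1 (yh_incl x) = hecke_incl (G n x).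
Proof.
have inclL : linear (@yh_incl rT d n) by exact: yh_incl_linear.
have inclM := yh_incl_monoid_morphism rT d n.
have hinclL : linear (@hecke_incl rT n) by exact: hecke_incl_linear.
have hinclM := hecke_incl_monoid_morphism rT n.
move: x; apply: (@pres_morph_ext _ _ _ _ _
  (fun x => G n.+1 (yh_incl x)) (fun x => hecke_incl (G n x))).
- by move=> a x y; rewrite inclL GL.
- by split=> [|x y]; rewrite ?inclM.1 ?(GM _).1 // inclM.2 (GM _).2.
- by move=> a x y; rewrite GL hinclL.
- by split=> [|x y]; rewrite ?(GM _).1 ?hinclM.1 // (GM _).2 hinclM.2.
case=> [i|j].
- rewrite -/(yhg rT d i) yh_incl_g !(yh_to_hecke_g d_gt0 zeta_root).
  by rewrite hecke_incl_gen.
- rewrite -/(yht rT d j) yh_incl_t !(yh_to_hecke_t d_gt0 zeta_root).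
  by rewrite (linear_funZ _ _ hinclL) hinclM.1.
Qed.

Lemma markov_trace_comp_hecke : markov_trace (fun n x => tau (G n x)).
Proof.
have [tauL _ tauC tauT] := tauP.
split=> [n a x y|n x y|n x].
- by rewrite GL tauL.
- rewrite ((GM n.+1).2 x y) ((GM n.+1).2 y x).
  exact: tauC.
have [g [gy yg]] := yhg_inv rT d (ord_max : 'I_n.+2.-1).
have [tauT1 tauT2] := tauT n (G n.+1 x).
rewrite ((GM n.+2).2 _ (yhg _ _ _)) ((GM n.+2).2 _ (two_sided_inv _)).
rewrite yh_to_hecke_incl (two_sided_inv_morph (GM n.+2) gy yg).
rewrite (yh_to_hecke_g d_gt0 zeta_root).
by split.
Qed.

(** Braids given by [beta] have [n.+1] strands, so agreement at positive indices suffices. Scalar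
    extension of a composite moves the specialization onto the braid image, which becomes pure and
    is evaluated by [tau]. *)
Lemma GammaY_comp_hecke (rho : forall n, yh rT d n -> LaurB rT) beta K :
  (forall n x, rho n.+1 x = tau (G n.+1 x)) ->
  GammaY beta rho K = BtoR (GammaH beta tau K).
Proof.
have [tauL _ _ _] := tauP.
move=> rhoE; rewrite /GammaY /GammaH; case: (beta K) => n b /=.
have -> : @rho n.+1 = @tau n.+1 \o G n.+1 by apply/funext => x; exact: rhoE.
rewrite -(extend_scalars_map (@GL n.+1) (GM n.+1) _ (tauL n.+1)).
rewrite (base_change_braid_image d_gt0 zeta_root).
by rewrite (extend_scalars_pure _ (tauL n.+1)).
Qed.

End PulledBackTrace.

(** * Reduced words of adjacent transpositions *)

Section AdjacentTranspositions.
Variable n : nat.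
Implicit Types i j : 'I_n.-1.

Lemma adj_inj : injective (@adj n).
Proof.
move=> i j ij; apply: val_inj => /=.
have := congr1 (fun w : 'S_n => w (lo j)) ij; rewrite /adj tpermL.
case: tpermP => [/(congr1 val) //=|/(congr1 val) /= jE|_ _] /(congr1 val) /=;
  last lia.
by move: jE => -> /esym; lia.
Qed.

Lemma adj_neq1 i : adj i <> 1%g.
Proof.
move/(congr1 (fun w : 'S_n => w (lo i))); rewrite /adj tpermL perm1.
by move/(congr1 val) => /= /esym; lia.
Qed.

Lemma word_perm1 i : word_perm [:: i] = adj i.
Proof. by apply/permP => j; rewrite /= permM perm1. Qed.

(** [reduced_word] is a choice, but here the reduced word is unique: it has at most one letter, is
    nonempty since [adj i] is not 1, and its letter is determined by [adj_inj]. *)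
Lemma reduced_word_adj i : reduced_word (adj i) = [:: i].
Proof.
rewrite /reduced_word; case: xgetP => [s _ [si smin]|/(_ [:: i])]; last first.
  case; split=> [|s' s'i]; first exact: word_perm1.
  by case: s' s'i => // /esym /adj_neq1.
have := smin _ (word_perm1 i).
case: s si {smin} => [/esym/adj_neq1//|j [|//]].
by rewrite word_perm1 => /adj_inj ->.
Qed.

End AdjacentTranspositions.

Section AdjacentBasis.
Variables (rT : realType) (n : nat) (i : 'I_n.-1).

Lemma heckeTw_adj : heckeTw rT (adj i) = u rT ^- 1 *: heckeT rT i.
Proof. by rewrite /heckeTw /perm_length reduced_word_adj big_seq1. Qed.

Lemma yhgw_adj d : yhgw rT d (adj i) = u rT ^- 1 *: yhg rT d i.
Proof. by rewrite /yhgw /perm_length reduced_word_adj big_seq1. Qed.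

End AdjacentBasis.

(** * Compositions concentrated at one index *)

Section Concentrated.
Variables (d n : nat) (d_gt0 : (0 < d)%N) (mu : comp_type d n) (a : 'I_d).
Hypotheses (mu_a : mu a = n :> nat)
  (mu_b : forall b, b != a -> mu b = 0%N :> nat).

Lemma conc_Comp : mu \in Comp d n.
Proof. by rewrite inE (bigD1 a) //= mu_a big1 ?addn0 // => b /mu_b. Qed.

Lemma conc_multinomial : multinomial mu = 1%N.
Proof.
rewrite /multinomial (bigD1 a) //= mu_a big1 => [|b /mu_b -> //].
by rewrite muln1 divnn fact_gt0.
Qed.

Lemma conc_block (j : 'I_n) : Defs.block d_gt0 mu j = a.
Proof.
rewrite /Defs.block; set s := flatten _.
(* The list has length [n], so [nth] never returns its default, and every entry comes from a
   nonempty block. *)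
have size_s : size s = n.
  rewrite size_flatten /shape -map_comp.
  rewrite (eq_map (g := fun b => mu b : nat)) => [|b]; last first.
    by rewrite /= size_nseq.
  rewrite sumnE big_map big_enum /=.
  by have := conc_Comp; rewrite inE => /eqP.
have : nth (Ordinal d_gt0) s j \in s by rewrite mem_nth // size_s.
move=> /flatten_mapP[b _]; rewrite mem_nseq => /andP[mub_gt0 /eqP ->].
by apply/eqP; apply: contraLR mub_gt0 => /mu_b ->.
Qed.

Lemma conc_char_comp (chi : character d n) :
  (char_comp chi == mu) = (chi == [ffun=> a]).
Proof.
have cardP b : (#|[set j | chi j == b]%SET| < n.+1)%N.
  by rewrite ltnS -[leqRHS]card_ord max_card.
apply/eqP/eqP => [chi_mu|chiE].
  have : #|[set j | chi j == a]%SET| = n.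
    by apply: etrans mu_a; rewrite -chi_mu ffunE inordK.
  move=> card_n; have : [set j | chi j == a]%SET == [set: 'I_n]%SET.
    by rewrite eqEcard finset.subsetT cardsT card_ord card_n leqnn.
  move=> /eqP/finset.setP allj; apply/ffunP => j; rewrite ffunE.
  by have := allj j; rewrite !inE => /eqP.
apply/ffunP => b; apply: val_inj; rewrite ffunE /= inordK //.
have [->|ba] := eqVneq b a.
  rewrite mu_a -[RHS]card_ord -cardsT; congr #|pred_of_set _|.
  by apply/finset.setP => j; rewrite !inE chiE ffunE eqxx.
rewrite mu_b //; apply/eqP; rewrite cards_eq0; apply/eqP/finset.setP => j.
by rewrite !inE chiE ffunE eq_sym (negbTE ba).
Qed.

Lemma conc_E_comp (rT : realType) (xi : 'I_d -> rT[i]) :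
  E_comp xi mu = E_char xi [ffun=> a].
Proof.
by rewrite /E_comp (big_pred1 [ffun=> a]) // => chi; rewrite /= conc_char_comp.
Qed.

End Concentrated.

Lemma prod_commr_eigen (K : idomainType) (I : choiceType)
    (rel : set (free_alg K I)) (T : eqType) (r : seq T)
    (F : T -> pres_alg rel) (t : pres_alg rel) (c : K) (j : T) :
  (forall i, GRing.comm t (F i)) -> F j * t = c *: F j -> j \in r ->
  (\prod_(i <- r) F i) * t = c *: \prod_(i <- r) F i.
Proof.
move=> tF Fj; elim: r => // i r IH; rewrite inE !big_cons.
case: (boolP (j \in r)) => [jr _|_].
  by rewrite -mulrA IH // pres_scalerAr.
rewrite orbF => /eqP <-; rewrite -mulrA.
have <- : t * \prod_(k <- r) F k = \prod_(k <- r) F k * t.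
  by apply: commr_prod => k _; apply: tF.
by rewrite mulrA Fj pres_scalerAl.
Qed.

(** The j-th factor of [E_char] is a multiple of the torsion sum of the scalar [xi (chi j)] and
    [yht j], and such a sum does not distinguish multiplication by one from multiplication by the
    other. *)
Lemma E_char_t (rT : realType) (d n : nat) (xi : 'I_d -> rT[i])
    (chi : character d n) (j : 'I_n) :
  xi (chi j) ^+ d = 1 ->
  E_char xi chi * yht rT d j = constB (xi (chi j)) *: E_char xi chi.
Proof.
move=> root; pose Q := yh rT d n.
have FE k : \sum_(s < d) constB (xi (chi k)) ^+ s *: yht rT d k ^+ (d - s) =
    \sum_(s < d) (constB (xi (chi k)) *: (1 : Q)) ^+ s * yht rT d k ^+ (d - s).
  by apply: eq_bigr => s _; rewrite pres_exprZ1 pres_mulZl.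
have commZ c (x : Q) : GRing.comm x (c *: (1 : Q)).
  by rewrite /GRing.comm pres_mulZl pres_mulZr.
apply: (@prod_commr_eigen _ _ _ _ _ _ _ _ j) => [k||]; last by rewrite mem_index_enum.
- rewrite /GRing.comm -pres_scalerAl -pres_scalerAr; congr (_ *: _).
  rewrite FE; apply: commr_sum => s _; apply: commrM; apply: commrX.
    exact: commZ.
  exact: yh_comm.
- rewrite -pres_scalerAl scalerA mulrC -scalerA FE; congr (_ *: _).
  rewrite -torsion_sumM ?pres_mulZr //; last exact/commr_sym/commZ.
    by rewrite pres_exprZ1 (constB_root root) scale1r.
  exact: yh_tors.
Qed.

Lemma prod_scalar_except (K : idomainType) (I : choiceType)
    (rel : set (free_alg K I)) (T : eqType) (r : seq T)
    (y : T -> pres_alg rel) (c : T -> K) (a : T) :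
  (forall b, b != a -> y b = c b *: (1 : pres_alg rel)) -> uniq r -> a \in r ->
  \prod_(b <- r) y b = (\prod_(b <- r | b != a) c b) *: y a.
Proof.
move=> yc.
have notin (s : seq T) : a \notin s ->
    \prod_(b <- s) y b = (\prod_(b <- s | b != a) c b) *: (1 : pres_alg rel).
  elim: s => [|b s IH]; first by rewrite !big_nil scale1r.
  rewrite inE negb_or !big_cons eq_sym => /andP[ba /IH ->].
  by rewrite ba (yc _ ba) pres_mulZl scalerA.
elim: r => // b r IH; rewrite !big_cons inE eq_sym /= => /andP[br r_uniq].
have [ba|ba] := eqVneq b a.
  by move=> _; rewrite notin -?ba // pres_mulZr.
by move=> /= /(IH r_uniq) ->; rewrite (yc _ ba) pres_mulZl scalerA.
Qed.

(** * The tensor product of traces on a single nontrivial factor *)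

Section TauTensor.
Variables (rT : realType) (tau : forall n, hecke rT n -> LaurB rT).
Hypothesis tauP : ocneanu_trace tau.

(** [hecke rT 0] has no generators, hence consists of scalars, which [tau] reads off. The index is a
    variable with [m = 0] because it will be [mu b], equal to 0 only propositionally. *)
Lemma hecke_shift_empty m n k (x : hecke rT m) : m = 0%N ->
  hecke_shift n k x = tau x *: (1 : hecke rT n).
Proof.
move=> m0; subst m.
have [tauS [tau1 _] _ _] := tauP.
set f := fun i : 'I_0 => oapp (@heckeT rT n) 1 (insub (k + i)%N).
have f_rel z : @hecke_rel rT 0 z -> free_lift f z = 0 by case=> -[].
have shL : linear (@hecke_shift rT 0 n k) by exact: (pres_lift_is_linear f_rel).
have [sh1 shM] : monoid_morphism (@hecke_shift rT 0 n k).
  exact: (pres_lift_is_monoid_morphism f_rel).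
have [c ->] : exists c, x = c *: (1 : hecke rT 0).
  elim/pres_ind: x => [|[]//|b x y [c ->] [c' ->]|x y [c ->] [c' ->]].
  - by exists 1; rewrite scale1r.
  - by exists (b * c + c'); rewrite scalerDl scalerA.
  - by exists (c * c'); rewrite pres_mulZl scalerA.
transitivity (c *: hecke_shift n k (1 : hecke rT 0)).
  exact: (linear_funZ c (1 : hecke rT 0) shL).
rewrite sh1.
have tauc : tau (c *: (1 : hecke rT 0)) = c.
  have tauoL : linear (@tau 0%N : hecke rT 0 -> (LaurB rT)^o) by exact: tauS.
  transitivity (c *: (tau (1 : hecke rT 0) : (LaurB rT)^o)).
    exact: (linear_funZ c (1 : hecke rT 0) tauoL).
  by rewrite tau1; apply: mulr1.
by rewrite tauc.
Qed.

Lemma hecke_shift_id n (x : hecke rT n) : hecke_shift n 0 x = x.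
Proof.
set f := fun i : 'I_n.-1 => oapp (@heckeT rT n) 1 (insub (0 + i)%N).
have fE i : f i = heckeT rT i by rewrite /f add0n valK.
have fL : linear (free_lift f) := @free_lift_is_linear _ _ _ _ _.
have fM := free_lift_is_monoid_morphism f.
have fg i : free_lift f (free_gen (LaurB rT) i) = heckeT rT i.
  by rewrite -fE; exact: free_lift_gen.
have f_rel z : @hecke_rel rT n z -> free_lift f z = 0.
  case=> {z} [i j ij|i j ij|i].
  - by rewrite (relator_comm fL fM) !fg (hecke_far rT ij) subrr.
  - by rewrite (relator_braid fL fM) !fg (hecke_near rT ij) subrr.
  - by rewrite (relator_quad fL fM) !fg hecke_quad subrr.
move: x; apply: (@pres_morph_ext _ _ _ _ _ (@hecke_shift rT n n 0) idfun).
- exact: (pres_lift_is_linear f_rel).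
- exact: (pres_lift_is_monoid_morphism f_rel).
- by move=> c x y.
- by split.
- by move=> i; rewrite -[RHS]fE; exact: (pres_lift_gen f_rel).
Qed.

Variables (d n : nat) (mu : comp_type d n) (a : 'I_d).
Hypotheses (mu_a : mu a = n :> nat)
  (mu_b : forall b, b != a -> mu b = 0%N :> nat).

Lemma conc_block_start : block_start mu a = 0%N.
Proof.
apply: big1 => b ba; apply: mu_b; apply: contraTneq ba => ->.
by rewrite ltnn.
Qed.

Lemma hecke_shift_full (x : hecke rT (mu a)) : tau (hecke_shift n 0 x) = tau x.
Proof.
move: (nat_of_ord (mu a)) mu_a x => m mn; subst m => x.
by rewrite hecke_shift_id.
Qed.

Lemma hecke_shift_surj y : exists x : hecke rT (mu a), hecke_shift n 0 x = y.
Proof.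
move: (nat_of_ord (mu a)) mu_a => m mn; subst m.
by exists y; rewrite hecke_shift_id.
Qed.

Lemma prod_hecke_shift (x : {dffun forall b : 'I_d, hecke rT (mu b)}) :
  \prod_(b < d) hecke_shift n (block_start mu b) (x b) =
  (\prod_(b < d | b != a) tau (x b)) *: hecke_shift n 0 (x a).
Proof.
have -> : hecke_shift n 0 (x a) = hecke_shift n (block_start mu a) (x a).
  by rewrite conc_block_start.
apply: (prod_scalar_except
  (y := fun b => hecke_shift n (block_start mu b) (x b))).
- by move=> b ba; apply: hecke_shift_empty; apply: mu_b.
- exact: index_enum_uniq.
- exact: mem_index_enum.
Qed.

(** Two things exclude the default of [xget] and any ambiguity: every decomposition of [y] yields
    [tau y], since the factors away from [a] are scalars, and a decomposition exists. *)
Lemma tau_tensor_conc y : tau_tensor tau mu y = tau y.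
Proof.
have [tauS [tau1 _] _ _] := tauP.
pose tauo : hecke rT n -> (LaurB rT)^o := @tau n.
have tauL : linear tauo by exact: tauS.
rewrite /tau_tensor; case: xgetP => [b _ [s [-> ->]]|].
  rewrite -/(tauo _).
  rewrite (big_morph _ (fun x y => linear_funD x y tauL) (linear_fun0 tauL)).
  apply: eq_bigr => x _.
  rewrite prod_hecke_shift (linear_funZ _ _ tauL) /tauo hecke_shift_full.
  by rewrite (bigD1 a) //= mulrC.
have [xa xaE] := hecke_shift_surj y.
(* The tensor with [y] in the factor [a] and 1 in all others. *)
pose x : {dffun forall b : 'I_d, hecke rT (mu b)} :=
  finfun (@eqtype.dfwith _ (fun b => hecke rT (mu b)) (fun=> 1) a xa).
move=> /(_ (\sum_(z <- [:: x]) \prod_(b < d) tau (z b))); case.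
exists [:: x]; split=> //; rewrite big_seq1 prod_hecke_shift.
rewrite ffunE eqtype.dfwith_in xaE big1 ?scale1r // => b ba.
rewrite ffunE eqtype.dfwith_out 1?eq_sym //.
move: (nat_of_ord (mu b)) (mu_b ba) => m m0; subst m.
exact: tau1.
Qed.

End TauTensor.

(** * The isomorphism Psi in the one by one case *)

Section ConcentratedPsi.
Variables (rT : realType) (d n : nat) (d_gt0 : (0 < d)%N) (xi : 'I_d -> rT[i]).
Hypothesis xi_root : forall a, xi a ^+ d = 1.
Variables (mu : comp_type d n) (a : 'I_d).
Hypotheses (mu_a : mu a = n :> nat)
  (mu_b : forall b, b != a -> mu b = 0%N :> nat).
Variables (p : 'I_(multinomial mu) -> 'S_n) (pP : min_rep_enum d_gt0 p).
Variable Psi : yh rT d n -> 'M[hecke rT n]_(multinomial mu).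
Hypothesis PsiP : is_Psi d_gt0 xi p Psi.
Local Notation E := (E_comp xi mu).
Local Notation Y := (yh rT d n).
Local Notation H := (hecke rT n).

Lemma conc_index_gt0 : (0 < multinomial mu)%N.
Proof. by rewrite (conc_multinomial mu_a mu_b). Qed.

Definition conc_index : 'I_(multinomial mu) := Ordinal conc_index_gt0.
Local Notation k0 := conc_index.

Lemma conc_indexP k : k = k0.
Proof.
apply: val_inj => /=; have := ltn_ord k.
by rewrite [X in (_ < X)%N](conc_multinomial mu_a mu_b) ltnS leqn0 => /eqP.
Qed.

Lemma sum_conc_index (V : zmodType) (F : 'I_(multinomial mu) -> V) :
  \sum_k F k = F k0.
Proof. by apply: big_pred1 => k; rewrite /= (conc_indexP k) eqxx. Qed.

Lemma conc_p k : p k = 1%g.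
Proof. by case: pP => _ _; apply; rewrite (conc_indexP k). Qed.

Lemma conc_chi k : chi_ d_gt0 p k = [ffun=> a].
Proof.
apply/ffunP => j; rewrite /chi_ conc_p !ffunE.
exact: (conc_block d_gt0 mu_a mu_b).
Qed.

Let EE : E = E_char xi (chi_ d_gt0 p k0).
Proof. by rewrite conc_chi (conc_E_comp mu_a mu_b). Qed.

Let inEY x : E * x \in range (fun y => E * y).
Proof. by apply/mem_set; exists x. Qed.

Definition Psi_entry (x : Y) : H := Psi (E * x) k0 k0.

Lemma Psi_entry_linear : linear Psi_entry.
Proof.
have [PL _ _ _ _] := PsiP.
move=> c x y; rewrite /Psi_entry mulrDr -pres_scalerAr PL ?inEY //.
by rewrite !mxE.
Qed.

(* Psi is multiplicative and injective on E Y, so this needs no commutation of E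
   with the generators g_i. *)
Lemma E_sandwich x : E * x * E = E * x.
Proof.
have [_ PM P1 [_ Pinj _] _] := PsiP.
have E_in : E \in range (fun y => E * y) by rewrite -[E in E \in _]mulr1 inEY.
apply: Pinj; first by rewrite -mulrA inEY.
  exact: inEY.
by rewrite PM ?inEY // P1 mulmx1.
Qed.

(** [E_sandwich] makes [x |-> E * x] multiplicative, and a product of one by one matrices is the
    product of their entries. *)
Lemma Psi_entry_monoid_morphism : monoid_morphism Psi_entry.
Proof.
have [_ PM P1 _ _] := PsiP.
split=> [|x y]; rewrite /Psi_entry; first by rewrite mulr1 P1 mxE eqxx.
have -> : E * (x * y) = E * x * (E * y) by rewrite [RHS]mulrA E_sandwich mulrA.
by rewrite PM ?inEY // mxE sum_conc_index.
Qed.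

(** The formula for [Psi] applies with [w = adj i], which fixes the constant character. The
    normalizing factor [u ^- 1] appears on both sides and cancels. *)
Lemma Psi_entry_g i : Psi_entry (yhg rT d i) = heckeT rT i.
Proof.
have [_ _ _ _ Pg] := PsiP.
have uU := u_unit rT.
have fix_chi : perm_char (adj i) (chi_ d_gt0 p k0) = chi_ d_gt0 p k0.
  by rewrite conc_chi; apply/ffunP => j; rewrite !ffunE.
have := congr1 (fun M : 'M[H]_(multinomial mu) => M k0 k0)
  (Pg k0 k0 (adj i) fix_chi).
rewrite -EE /= !mxE !eqxx mulr1 !conc_p.
have -> : Defs.pcomp 1^-1%g (Defs.pcomp (adj i) 1%g) = adj i.
  by apply/permP => j; rewrite invg1 !permM !perm1.
rewrite yhgw_adj heckeTw_adj -/(Psi_entry _).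
rewrite (linear_funZ _ _ Psi_entry_linear).
move/(congr1 (fun y : H => u rT *: y)).
by rewrite !scalerA expr1 mulrV // !scale1r.
Qed.

(** The formula for [Psi] speaks only of the elements [E_chi g_w]; the value at [t_j] comes instead
    from [E] being an eigenvector of [t_j]. *)
Lemma Psi_entry_t j : Psi_entry (yht rT d j) = constB (xi a) *: (1 : H).
Proof.
have Et : E * yht rT d j = constB (xi a) *: E.
  rewrite (conc_E_comp mu_a mu_b) E_char_t ffunE //; exact: xi_root.
have [Phi1 _] := Psi_entry_monoid_morphism.
rewrite -Phi1 -(linear_funZ _ _ Psi_entry_linear) /Psi_entry.
by rewrite Et -pres_scalerAr mulr1.
Qed.

Lemma Psi_entryE : Psi_entry =1 yh_to_hecke (xi a).
Proof.
apply: (@pres_morph_ext _ _ _ _ _ Psi_entry (@yh_to_hecke rT d n (xi a))).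
- exact: Psi_entry_linear.
- exact: Psi_entry_monoid_morphism.
- exact: (yh_to_hecke_linear d_gt0 (xi_root a)).
- exact: (yh_to_hecke_monoid_morphism n d_gt0 (xi_root a)).
case=> [i|j].
- rewrite -/(yhg rT d i) (yh_to_hecke_g d_gt0 (xi_root a)).
  exact: Psi_entry_g.
- rewrite -/(yht rT d j) (yh_to_hecke_t d_gt0 (xi_root a)).
  exact: Psi_entry_t.
Qed.

Lemma trace_Psi x : \tr (Psi (E * x)) = yh_to_hecke (xi a) x.
Proof. by rewrite /mxtrace sum_conc_index -Psi_entryE. Qed.

End ConcentratedPsi.

(** * Basic traces with support of size one *)

Lemma Comp1P d (mu0 : comp_type d 1) : mu0 \in Comp d 1 ->
  exists a, forall b, (mu0 b : nat) = (b == a).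
Proof.
rewrite inE => /eqP sum1.
have [a mua] : exists a, (0 < mu0 a)%N.
  apply/existsP; apply: contraT => /existsPn all0.
  have := sum1; rewrite big1 // => b _.
  by apply/eqP; rewrite -leqn0 leqNgt all0.
have mua1 : mu0 a = 1%N :> nat.
  by apply/eqP; rewrite eqn_leq mua andbT -ltnS ltn_ord.
exists a => b; have [->//|ba] := eqVneq b a.
move: sum1; rewrite (bigD1 a) //= mua1 (bigD1 b) //=.
by move=> /eqP; rewrite eqSS addn_eq0 => /andP[/eqP].
Qed.

Section BasicTrace.
Variables (rT : realType) (d : nat) (d_gt0 : (0 < d)%N) (xi : 'I_d -> rT[i]).
Hypothesis xi_root : forall a, xi a ^+ d = 1.
Variables (tau : forall n, hecke rT n -> LaurB rT) (tauP : ocneanu_trace tau).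
Variable p : forall n (mu : comp_type d n), 'I_(multinomial mu) -> 'S_n.
Hypothesis pP : forall n (mu : comp_type d n), mu \in Comp d n ->
  min_rep_enum d_gt0 (@p n mu).
Variable Psi : forall n (mu : comp_type d n),
  yh rT d n -> 'M[hecke rT n]_(multinomial mu).
Hypothesis PsiP : forall n (mu : comp_type d n), mu \in Comp d n ->
  is_Psi d_gt0 xi (@p n mu) (@Psi n mu).

(** A composition of 1 has entries 0 and 1, so [mu0] serves directly as a support. The index is
    [n.+1] because the only composition of 0 has empty support, which would leave no term in the
    sum. *)
Lemma basic_traceE (mu0 : comp_type d 1) a n (x : yh rT d n.+1) :
  (forall b, (mu0 b : nat) = (b == a)) ->
  basic_trace xi tau Psi mu0 x = tau (yh_to_hecke (xi a) x).
Proof.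
move=> mu0E; pose mu : comp_type d n.+1 := [ffun b => inord (n.+1 * (b == a))].
have muE b : mu b = (n.+1 * (b == a))%N :> nat.
  by rewrite ffunE inordK // ltnS; case: (b == a); rewrite ?muln1 ?muln0.
have mu_a : mu a = n.+1 :> nat by rewrite muE eqxx muln1.
have mu_b b : b != a -> mu b = 0%N :> nat.
  by move=> /negbTE ba; rewrite muE ba muln0.
have muC := conc_Comp mu_a mu_b.
rewrite /basic_trace (big_pred1 mu) => [|nu /=].
  rewrite (tau_tensor_conc tauP mu_a mu_b); congr tau.
  exact: (trace_Psi xi_root mu_a mu_b (pP muC) (PsiP muC)).
have suppE b : (comp_supp nu b : nat) = (0 < nu b)%N.
  by rewrite ffunE inordK //; case: (0 < nu b)%N.
apply/andP/eqP => [[nuC /eqP nu_mu0]|->].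
  have nu_b b : b != a -> nu b = 0%N :> nat.
    move=> /negbTE ba; have := suppE b; rewrite nu_mu0 mu0E ba.
    by case: (nat_of_ord (nu b)).
  apply/ffunP => b; apply: val_inj => /=.
  have [->|/[dup] ba /nu_b ->] := eqVneq b a; last by rewrite mu_b.
  rewrite mu_a; move: nuC; rewrite inE (bigD1 a) //=.
  by rewrite big1 ?addn0 => [/eqP|c /nu_b].
split; first exact: muC.
apply/eqP/ffunP => b; apply: val_inj; rewrite /= mu0E.
rewrite ffunE inordK; last by case: (0 < _)%N.
by rewrite muE; case: (b == a); rewrite ?muln1 ?muln0.
Qed.

End BasicTrace.

(** * The HOMFLYPT polynomial among the invariants *)

Theorem proposition6p7
  (rT : realType) (d : nat) (d_gt0 : (0 < d)%N)
  (xi : 'I_d -> rT[i])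
  (xi_inj : injective xi) (xi_root : forall a, xi a ^+ d = 1)
  (tau : forall n, hecke rT n -> LaurB rT) (tauP : ocneanu_trace tau)
  (p : forall n (mu : comp_type d n), 'I_(multinomial mu) -> 'S_n)
  (pP : forall n (mu : comp_type d n), mu \in Comp d n ->
     min_rep_enum d_gt0 (p n mu))
  (Psi : forall n (mu : comp_type d n),
     yh rT d n -> 'M[hecke rT n]_(multinomial mu))
  (PsiP : forall n (mu : comp_type d n), mu \in Comp d n ->
     is_Psi d_gt0 xi (p n mu) (Psi n mu))
  (beta : classical_link rT -> {n : nat & braid n.+1})
  (betaP : forall K, is_closure (projT2 (beta K)) K) :
  (forall mu0 : comp_type d 1, mu0 \in Comp d 1 ->
   forall K : classical_link rT,
     GammaY beta (fun n => @basic_trace rT d xi tau Psi mu0 n) K =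
     BtoR (GammaH beta tau K))
  /\
  [set GammaY beta rho | rho in @markov_trace rT d]
    (fun K => BtoR (GammaH beta tau K)).
Proof.
split=> [mu0 /Comp1P[a mu0E] K|].
  apply: (GammaY_comp_hecke d_gt0 (xi_root a) tauP) => n x.
  exact: (basic_traceE xi_root tauP pP PsiP _ mu0E).
(* The Markov trace exhibited is [tau] pulled back along the specialization at [xi a]; its Markov
   property is inherited from [tau]. *)
pose a := Ordinal d_gt0.
exists (fun n x => tau n (yh_to_hecke (xi a) x)).
  exact: (markov_trace_comp_hecke d_gt0 (xi_root a) tauP).
apply/funext => K.
exact: (GammaY_comp_hecke d_gt0 (xi_root a) tauP).
Qed.
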